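(* Let $0<a<b$, $L>0$ and $V_0>0$. Assume that $V\in C^{\infty}(\mathbf{R}^2)$ is a bounded real-valued function with $$0<\frac{V_0}{1+|x|}\le V(x)\le \|V\|_{L^\infty}<+\infty\quad (x\in\mathbf{R}^2),$$ and that $u_0,u_1\in (C_0^\infty(\mathbf{R}^2))^2$ satisfy $\mathrm{supp}\,u_0\cup \mathrm{supp}\,u_1\subset\{|x|\le L\}$. Let $u(t,x)\in\mathbf{R}^2$ be the smooth solution of the Cauchy problem $$u_{tt}-a^2\Delta u-(b^2-a^2)\nabla\,\mathrm{div}\,u+V(x)u_t=0,\quad (t,x)\in(0,\infty)\times\mathbf{R}^2,$$ $$u(0,x)=u_0(x),\quad u_t(0,x)=u_1(x),\quad x\in\mathbf{R}^2,$$ and let $$E_u(t)=\frac12\int_{\mathbf{R}^2}\left(|u_t(t,x)|^2+a^2|\nabla u(t,x)|^2+(b^2-a^2)(\mathrm{div}\,u(t,x))^2\right)dx .$$ Then: (1) if $V_0>2b$, then $E_u(t)=O(t^{-2}\log t)$ as $t\to\infty$; (2) if $b<V_0\le 2b$, then for any small $\delta>0$, $E_u(t)=O(t^{-\frac{V_0}{b}+\delta}\log t)$ as $t\to\infty$.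
   Context: For a vector field $u=(u^{(1)},u^{(2)})^T$ on $\mathbf{R}^2$: $|u|^2=|u^{(1)}|^2+|u^{(2)}|^2$, $|\nabla u|^2=|\nabla u^{(1)}|^2+|\nabla u^{(2)}|^2$, $\Delta u=(\Delta u^{(1)},\Delta u^{(2)})^T$, $\mathrm{div}\,u=\partial_{x_1}u^{(1)}+\partial_{x_2}u^{(2)}$; $\nabla$ and $\mathrm{div}$ act in the space variables only. For such data the Cauchy problem has a unique smooth (classical) solution, and it satisfies the finite propagation speed property $u(t,x)=0$ for $|x|>bt+L$. *)

(* Defs.v *)
From mathcomp Require Import all_boot all_order all_algebra.
From mathcomp Require Import all_classical all_reals all_analysis.

Set Implicit Arguments.
Unset Strict Implicit.
Unset Printing Implicit Defensive.

Import Order.TTheory GRing.Theory Num.Theory.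
Import numFieldNormedType.Exports.

Local Open Scope classical_set_scope.
Local Open Scope ring_scope.

(* The plane is R * R, whose library norm is the sup norm; the Euclidean
   length |x| is enorm below.  Topology and differentiability do not depend on
   the choice of norm. *)
Definition sqnorm (R : realType) (x : R * R) : R := x.1 ^+ 2 + x.2 ^+ 2.
Definition enorm (R : realType) (x : R * R) : R := Num.sqrt (sqnorm x).

(* In finite dimension, f is of class C^(k+1) iff it is differentiable and all
   its directional derivatives are of class C^k. *)
Fixpoint Ck (R : realType) (U W : normedModType R) (k : nat) (f : U -> W)
    : Prop :=
  if k is k'.+1 then
    (forall x, differentiable f x) /\ (forall v, Ck k' (fun x => 'D_v f x))
  else continuous f.

Definition smooth (R : realType) (U W : normedModType R) (f : U -> W) : Prop :=
  forall k, Ck k f.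

Definition fsupp (T : topologicalType) (W : zmodType) (f : T -> W) : set T :=
  closure [set x | f x != 0].

Definition test_function (R : realType) (U W : normedModType R) (f : U -> W)
    : Prop :=
  smooth f /\ compact (fsupp f).

(* C^oo([0, oo[ x R^2): smoothness up to t = 0 means being the restriction of a
   smooth function on R x R^2.  The values u t x for t < 0 are irrelevant. *)
Definition smooth_on_halfspace (R : realType) (u : R -> R * R -> R * R)
    : Prop :=
  exists2 w : R * (R * R) -> R * R,
    smooth w & forall t x, 0 <= t -> u t x = w (t, x).

Definition d1 (R : realType) (f : R * R -> R) (x : R * R) : R :=
  'D_((1, 0) : R * R) f x.
Definition d2 (R : realType) (f : R * R -> R) (x : R * R) : R :=
  'D_((0, 1) : R * R) f x.

Definition grad (R : realType) (f : R * R -> R) (x : R * R) : R * R :=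
  (d1 f x, d2 f x).

Definition laplacian (R : realType) (f : R * R -> R) (x : R * R) : R :=
  d1 (d1 f) x + d2 (d2 f) x.

Definition comp1 (R : realType) (v : R * R -> R * R) (x : R * R) : R :=
  (v x).1.
Definition comp2 (R : realType) (v : R * R -> R * R) (x : R * R) : R :=
  (v x).2.

Definition vlaplacian (R : realType) (v : R * R -> R * R) (x : R * R) : R * R :=
  (laplacian (comp1 v) x, laplacian (comp2 v) x).

Definition divergence (R : realType) (v : R * R -> R * R) (x : R * R) : R :=
  d1 (comp1 v) x + d2 (comp2 v) x.

Definition sqnorm_grad (R : realType) (v : R * R -> R * R) (x : R * R) : R :=
  sqnorm (grad (comp1 v) x) + sqnorm (grad (comp2 v) x).

Definition dt (R : realType) (u : R -> R * R -> R * R) (t : R) (x : R * R)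
    : R * R :=
  'D_1 (fun s : R => u s x) t.

Definition elastic_equation (R : realType) (a b : R) (V : R * R -> R)
    (u : R -> R * R -> R * R) : Prop :=
  forall (t : R) (x : R * R), 0 < t ->
    dt (dt u) t x - (a ^+ 2) *: vlaplacian (u t) x
      - (b ^+ 2 - a ^+ 2) *: grad (divergence (u t)) x
      + V x *: dt u t x = 0.

(* Only t >= 0 is meaningful, hence the one-sided derivative at t = 0. *)
Definition initial_data (R : realType) (u : R -> R * R -> R * R)
    (u0 u1 : R * R -> R * R) : Prop :=
  forall x : R * R, u 0 x = u0 x /\
    h^-1 *: (u h x - u 0 x) @[h --> 0^'+] --> u1 x.

Definition lebesgue2 (R : realType) :=
  ((@lebesgue_measure R) \x (@lebesgue_measure R))%E.

(* Extended-real valued, so that a divergent integral is +oo. *)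
Definition energy (R : realType) (a b : R) (u : R -> R * R -> R * R) (t : R)
    : \bar R :=
  ((2^-1)%:E * \int[@lebesgue2 R]_x
     (sqnorm (dt u t x) + a ^+ 2 * sqnorm_grad (u t) x
      + (b ^+ 2 - a ^+ 2) * (divergence (u t) x) ^+ 2)%:E)%E.

(* Lets landau's =O_F notation be used at +oo. *)
Canonical pinfty_filter_on (R : realType) :=
  FilterType (pinfty_nbhs R) (@filter_filter _ _ proper_pinfty_nbhs).

(* f(t) = O(g(t)) as t -> oo, for an extended-real valued f: the finiteness
   clause excludes the junk value fine +oo = 0. *)
Definition ebigO_pinfty (R : realType) (f : R -> \bar R) (g : R -> R) : Prop :=
  (\forall t \near +oo, f t \is a fin_num) /\
  (fun t : R => fine (f t) : R) =O_+oo g.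

(* Main.v *)
(* Let tau = t + (1 + L) / b, so that V >= (V0 / b) / tau on the region |x| <= b t + L
   where u lives.  Combining the multipliers tau^k u_t and (k / 2) tau^(k - 1) u, with
   1 < k <= min (2, V0 / b), all terms in u_t and in the gradient of u have the right
   sign, so that tau^k E(t) is controlled by initial data plus the time integral of
   N = \int V |u|^2.  To bound the latter, let v be the time primitive of u: it solves the
   same equation with source F = u_1 + V u_0, and its energy identity bounds the integral
   of N by \int F.v - E_v(t).  As F has compact support and v is supported in a ball of
   radius O(t), a Hardy inequality with a logarithmic constant bounds this by O(log t).
   The condition k < 2 (V0 / b - k + 1) makes the weighted energy coercive: k = 2 is
   allowed as soon as V0 > 2 b, and k = V0 / b - delta otherwise.

   Functions of (t, x) are curried, and integrals over the plane are iterated integrals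
   over a large square, with support properties obtained from an energy estimate in
   backward light cones. *)
Require Import Defs.
From mathcomp Require Import all_boot all_order all_algebra.
From mathcomp Require Import all_classical all_reals all_analysis.
From mathcomp Require Import measurable_realfun ring lra.
Import Order.TTheory GRing.Theory Num.Theory.
Import numFieldNormedType.Exports.
Local Open Scope classical_set_scope.
Local Open Scope ring_scope.

Set Implicit Arguments.
Unset Strict Implicit.
Unset Printing Implicit Defensive.

(** * Integrals over intervals depending on a parameter *)

(** The multiplier of [u] and the correction [- k (k - 1) / 4 tau^(k - 2) |u|^2] are tuned so that,
    when the weighted energy is differentiated, the potential terms and the cross terms [u . u_t]
    cancel exactly; what the damping does not absorb is controlled by [tau^(k - 2) N]. This weight
    is bounded precisely when [k <= 2], which caps the rate obtained at [t^(-2)]. In the plane, a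
    Hardy inequality with weight [(1 + |x|^2)^(-2)] cannot hold with a constant independent of the
    support; a constant growing like the logarithm of the radius is the price, and it becomes the
    factor [log t] of the result. A final time [T] is fixed, and all integrals up to [T] are taken
    over one square of half-side [b T + L + 1], whose boundary the solution does not reach. No
    moving domain is differentiated, and the quantities at time 0 do not depend on [T] because the
    data live in a fixed disc. The same pointwise identities serve for [u] and for its time
    primitive, so they are stated without the equation, with the residual of the elastic operator
    left in. *)

Lemma is_derive1_epsP (R : realType) (f : R -> R) (x d : R) :
  is_derive x 1 f d <->
  forall e, 0 < e -> \forall h \near 0^', `|h^-1 * (f (h + x) - f x) - d| <= e.
Proof.
have E : (fun h : R => h^-1 *: ((f \o shift x) (h *: 1) - f x)) =
         (fun h : R => h^-1 * (f (h + x) - f x)).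
  by apply/funext => h /=; rewrite /GRing.scale /= mulr1.
split.
  move=> df e e0; have [cf fd] := df.
  move: cf; rewrite /derivable E => cf.
  have : (fun h : R => h^-1 * (f (h + x) - f x)) @ 0^' --> d.
    by rewrite -fd /derive E.
  move/cvgrPdist_le => /(_ _ e0); apply: filterS => h.
  by rewrite distrC.
move=> H.
have C : (fun h : R => h^-1 * (f (h + x) - f x)) @ 0^' --> d.
  apply/cvgrPdist_le => e e0; move: (H e e0); apply: filterS => h.
  by rewrite distrC.
constructor.
  by rewrite /derivable E; apply/cvg_ex; exists d.
by rewrite /derive E; apply/cvg_lim.
Qed.

Lemma is_derive1_continuous (R : realType) (f f' : R -> R) :
  (forall x : R, is_derive x 1 f (f' x)) -> continuous f.
Proof.
move=> df x; apply/differentiable_continuous/derivable1_diffP.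
exact: (@ex_derive _ _ _ _ _ _ _ (df x)).
Qed.

Section interval_integral.
Context {R : realType}.
Implicit Types (f g F : R -> R) (c d : R).

Definition int_cc c d f : R := \int[@lebesgue_measure R]_(x in `[c, d]) f x.

Lemma int_cc_integrable c d f : continuous f ->
  (@lebesgue_measure R).-integrable `[c, d] (EFin \o f).
Proof.
move=> cf; apply: continuous_compact_integrable; first exact: segment_compact.
exact: continuous_subspaceT.
Qed.

Lemma eq_int_cc c d f g : (forall x, c <= x <= d -> f x = g x) ->
  int_cc c d f = int_cc c d g.
Proof.
move=> fg; apply: eq_Rintegral => x; rewrite inE /= in_itv /=.
exact: fg.
Qed.

Lemma int_ccD c d f g : continuous f -> continuous g ->
  int_cc c d (fun x => f x + g x) = int_cc c d f + int_cc c d g.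
Proof. by move=> cf cg; apply: RintegralD => //; exact: int_cc_integrable. Qed.

Lemma int_ccB c d f g : continuous f -> continuous g ->
  int_cc c d (fun x => f x - g x) = int_cc c d f - int_cc c d g.
Proof. by move=> cf cg; apply: RintegralB => //; exact: int_cc_integrable. Qed.

Lemma int_ccZ c d k f : continuous f ->
  int_cc c d (fun x => k * f x) = k * int_cc c d f.
Proof. by move=> cf; apply: RintegralZl => //; exact: int_cc_integrable. Qed.

Lemma int_cc_cst c d k : c <= d -> int_cc c d (fun=> k) = k * (d - c).
Proof.
move=> cd; rewrite /int_cc Rintegral_cst//= lebesgue_measure_itv /=.
by case: ifPn => //=; rewrite lte_fin -leNgt => dc; rewrite (@le_anti _ _ c d) ?cd// subrr.
Qed.

Lemma le_int_cc c d f g : continuous f -> continuous g ->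
  (forall x, c <= x <= d -> f x <= g x) -> int_cc c d f <= int_cc c d g.
Proof.
move=> cf cg fg; apply: le_Rintegral => //; try exact: int_cc_integrable.
Qed.

Lemma int_cc_dist c d f g (e : R) : c <= d -> continuous f -> continuous g ->
  (forall x, c <= x <= d -> `|f x - g x| <= e) ->
  `|int_cc c d f - int_cc c d g| <= e * (d - c).
Proof.
move=> cd cf cg fg; rewrite -int_ccB//.
have cfg : continuous (fun x => f x - g x).
  by move=> x; apply: cvgB; [exact: cf|exact: cg].
apply: (le_trans (le_normr_Rintegral _ _)) => //; first exact: int_cc_integrable.
rewrite -int_cc_cst//; apply: le_int_cc => // x; last exact: cvg_cst.
by apply: cvg_norm; exact: cfg.
Qed.

Lemma int_cc_FTC c d f F : c <= d -> continuous f ->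
  (forall x : R, is_derive x 1 F (f x)) -> int_cc c d f = F d - F c.
Proof.
rewrite le_eqVlt => /predU1P[-> _ _|cd cf dF].
  by rewrite subrr /int_cc set_itv1 Rintegral_set1.
have cF := is_derive1_continuous dF.
rewrite /int_cc /Rintegral (@continuous_FTC2 _ _ F)//.
- exact: continuous_subspaceT.
- split.
  + by move=> x _; exact: (@ex_derive _ _ _ _ _ _ _ (dF x)).
  + by apply: cvg_at_right_filter; exact: cF.
  + by apply: cvg_at_left_filter; exact: cF.
- by move=> x _; rewrite derive1E; exact: (@derive_val _ _ _ _ _ _ _ (dF x)).
Qed.

Lemma int_cc_itvD c m d f : c <= m -> m <= d -> continuous f ->
  int_cc c d f = int_cc c m f + int_cc m d f.
Proof.
move=> cm md cf; apply/eqP; rewrite addrC -subr_eq; apply/eqP.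
rewrite /int_cc Rintegral_itvB//.
- rewrite Rintegral_itv_obnd_cbnd//.
  by apply: integrableS (int_cc_integrable c d cf) => //; apply: subset_itvr; rewrite bnd_simp.
- exact: int_cc_integrable.
Qed.

Lemma int_cc_eq0 c d f : (forall x, c <= x <= d -> f x = 0) -> int_cc c d f = 0.
Proof.
move=> f0; rewrite (@eq_int_cc _ _ _ (fun=> 0)) //.
by rewrite /int_cc Rintegral_cst// mul0r.
Qed.

Lemma int_cc_supp c c' d' d f : c <= c' -> c' <= d' -> d' <= d -> continuous f ->
  (forall x, ~~ (c' < x < d') -> f x = 0) -> int_cc c d f = int_cc c' d' f.
Proof.
move=> cc' cd' dd' cf f0.
rewrite (@int_cc_itvD _ c')//; last exact: le_trans dd'.
rewrite (@int_cc_itvD c' d')// (@int_cc_eq0 c c').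
  rewrite (@int_cc_eq0 d' d) ?add0r ?addr0// => x /andP[dx _].
  by apply: f0; rewrite negb_and -!leNgt dx orbT.
by move=> x /andP[_ xc]; apply: f0; rewrite negb_and -!leNgt xc.
Qed.

(** A positive value at an interior point [x] would keep [f] above [f x / 2] on a short segment to
    the right of [x], and this segment alone makes the integral positive. *)
Lemma int_cc_gt0_eq0 c d f : continuous f -> (forall x, c <= x <= d -> 0 <= f x) ->
  int_cc c d f <= 0 -> forall x, c < x < d -> f x = 0.
Proof.
move=> cf f0 If x /andP[cx xd]; apply/eqP; rewrite eq_le [X in _ && X]f0; last by rewrite !ltW.
rewrite andbT leNgt.
apply/negP => fx0.
have : \forall y \near x, f x / 2 < f y.
  by have := cf x; move=> /cvgr_gt; apply; rewrite gtr_pMr ?invf_lt1 ?ltr1n.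
have : \forall y \near x, y < d by exact: lt_nbhsl.
move=> H1 H3.
have [e /= e0 He] := filterI H1 H3.
have xe1 y : x <= y <= x + e / 2 -> y < d /\ f x / 2 < f y.
  move=> /andP[xy yx]; have [] // := He y.
  rewrite /ball /= ltr_norml; apply/andP; split; lra.
have [xed _] := xe1 (x + e / 2) ltac:(lra).
move: If; apply/negP; rewrite -ltNge.
rewrite (@int_cc_itvD _ x) ?ltW// (@int_cc_itvD x (x + e/2)) ?ltW//; last lra.
apply: ltr_wpDl; first by apply: Rintegral_ge0 => y; rewrite /= in_itv /= => Hy; apply: f0; lra.
apply: ltr_pwDl; last by apply: Rintegral_ge0 => y; rewrite /= in_itv /= => Hy; apply: f0; lra.
apply: (@lt_le_trans _ _ (int_cc x (x + e / 2) (fun=> f x / 2))).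
  by rewrite int_cc_cst; [apply: mulr_gt0; lra | lra].
apply: le_int_cc => //; first by move=> ?; exact: cvg_cst.
by move=> y /xe1[_ /ltW].
Qed.

End interval_integral.

Lemma continuous_section (S T U : topologicalType) (g : S -> T -> U) (p : S) :
  continuous (fun q : S * T => g q.1 q.2) -> continuous (g p).
Proof.
move=> cg y.
have : (fun y => (p, y)) @ y --> (p, y) by apply: cvg_pair; [exact: cvg_cst|exact: cvg_id].
by move=> py; exact: (@cvg_comp _ _ _ (fun y => (p, y)) _ _ _ _ py (cg (p, y))).
Qed.

Section parameter.
Context {R : realType}.

(** Tube argument: joint continuity gives the estimate near each [(p0, y)], and compactness of the
    segment yields one neighbourhood of [p0] valid for all [y]. *)
Lemma near_segment (T : topologicalType) (g : T -> R -> R) (c d e : R) (p0 : T) :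
  continuous (fun q : T * R => g q.1 q.2) -> 0 < e ->
  \forall p \near p0, forall y, c <= y <= d -> `|g p y - g p0 y| <= e.
Proof.
move=> cg e0.
have /compact_near_coveringP H := @segment_compact R c d.
have := H _ (nbhs p0) (fun p y => `|g p y - g p0 y| <= e) _.
have h y : `[c, d]%classic y ->
    \forall y' \near y & p \near p0, `|g p y' - g p0 y'| <= e.
  move=> _; have e20 : 0 < e / 2 by lra.
  have /cvgrPdist_le/(_ _ e20) := cg (p0, y).
  case=> -[A B] /= [Ap0 By] AB.
  exists (B, A) => //=.
  move=> [y' p] /= [By' Ap].
  have := AB (p, y') (conj Ap By').
  have := AB (p0, y') (conj (nbhs_singleton Ap0) By').
  rewrite /= => h1 h2.
  rewrite (_ : _ - _ = (g p0 y - g p0 y') - (g p0 y - g p y')); last by ring.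
  apply: (le_trans (ler_normB _ _)); lra.
move=> /(_ _ h); apply: filterS => p Hp y ycd; apply: Hp.
by rewrite /= in_itv.
Qed.

Lemma continuous_param (T : topologicalType) (g : T -> R -> R) (c d : R) :
  c <= d -> continuous (fun q : T * R => g q.1 q.2) ->
  continuous (fun p => int_cc c d (g p)).
Proof.
move=> cd cg p0.
have cgp p : continuous (g p).
  exact: continuous_section.
apply/cvgrPdist_le => e e0.
(* The [+ 1] keeps the denominator positive when [c = d]. *)
have e'0 : 0 < e / (d - c + 1) by apply: divr_gt0 => //; lra.
have := @near_segment _ g c d _ p0 cg e'0; apply: filterS => p Hp.
rewrite distrC; apply: (le_trans (@int_cc_dist _ _ _ _ _ _ cd (cgp p) (cgp p0) Hp)).
by rewrite mulrAC ler_pdivrMr; [nra|lra].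
Qed.

(** Leibniz rule: the mean value theorem replaces each difference quotient by [g'] at an
    intermediate parameter, and [near_segment] makes its distance to [g' s y] small uniformly in
    [y]. *)
Lemma is_derive_param (g g' : R -> R -> R) (c d : R) (s : R) : c <= d ->
  (forall s, continuous (g s)) ->
  continuous (fun q : R * R => g' q.1 q.2) ->
  (forall s y : R, is_derive s 1 (g^~ y) (g' s y)) ->
  is_derive s 1 (fun s => int_cc c d (g s)) (int_cc c d (g' s)).
Proof.
move=> cd cg cg' dg; apply/is_derive1_epsP => e e0.
have cg's s' : continuous (g' s').
  exact: continuous_section.
have e'0 : 0 < e / (d - c + 1) by apply: divr_gt0 => //; lra.
have [r /= r0 Hr] := @near_segment _ g' c d _ s cg' e'0.
exists r => //= h; rewrite /ball /= sub0r normrN => hr h0.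
have dq y : c <= y <= d ->
    `|h^-1 * (g (h + s) y - g s y) - g' s y| <= e / (d - c + 1).
  move=> ycd.
  have cgy a b : {within `[a, b], continuous (g^~ y)}.
    by apply: continuous_subspaceT; apply: (is_derive1_continuous (dg^~ y)).
  have [h_gt|h_lt|] := ltrgtP 0 h; last by move=> E; rewrite E eqxx in h0.
  - have [//|z] := @MVT R (g^~ y) (g'^~ y) s (h + s) _ (fun x _ => dg x y) (cgy _ _).
      lra.
    rewrite in_itv /= => /andP[sz zh] ->.
    rewrite (_ : _ - _ = g' z y - g' s y); last by field.
    apply: Hr => //; rewrite /ball /=; move: hr; rewrite !ltr_norml; lra.
  - have [//|z] := @MVT R (g^~ y) (g'^~ y) (h + s) s _ (fun x _ => dg x y) (cgy _ _).
      lra.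
    rewrite in_itv /= => /andP[sz zh] E.
    rewrite (_ : _ - _ = g' z y - g' s y).
      apply: Hr => //; rewrite /ball /=; move: hr; rewrite !ltr_norml; lra.
    rewrite -[X in h^-1 * X]opprB E; by field.
rewrite -int_ccB// -int_ccZ; last first.
  by move=> y; apply: cvgB; [exact: cg|exact: cg].
have := @int_cc_dist _ c d (fun y => h^-1 * (g (h + s) y - g s y)) (g' s) _ cd _ (cg's s) dq.
move=> /(_ _)/le_trans; apply.
  by move=> y; apply: cvgMr; apply: cvgB; exact: cg.
by rewrite mulrAC ler_pdivrMr; [nra|lra].
Qed.

End parameter.

(** * Partial derivatives and integrals over boxes *)

Section continuity.
Context {S T U : topologicalType}.

Lemma continuous_comp2 (f : S -> T) (g : T -> U) :
  continuous f -> continuous g -> continuous (fun s => g (f s)).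
Proof. by move=> cf cg s; exact: (continuous_comp (cf s) (cg (f s))). Qed.

Lemma continuous_pair (f : S -> T) (g : S -> U) :
  continuous f -> continuous g -> continuous (fun s => (f s, g s)).
Proof. by move=> cf cg s; exact: (cvg_pair (cf s) (cg s)). Qed.

Lemma continuous_fst : continuous (@fst S T).
Proof. by move=> p; exact: cvg_fst. Qed.

Lemma continuous_snd : continuous (@snd S T).
Proof. by move=> p; exact: cvg_snd. Qed.

Lemma continuous_cst (c : T) : continuous (fun _ : S => c).
Proof. by move=> p; exact: cvg_cst. Qed.

Lemma continuous_idfun : continuous (fun s : S => s).
Proof. by move=> p; exact: cvg_id. Qed.

End continuity.

Inductive axis := AT | AX | AY.

Section partial_derivatives.
Context {R : realType}.
Implicit Types (f g : R -> R -> R -> R) (i : axis).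

Definition cont3 f := continuous (fun p : R * R * R => f p.1.1 p.1.2 p.2).

Definition slice i f (t x y : R) : R -> R :=
  match i with
  | AT => fun s => f s x y
  | AX => fun s => f t s y
  | AY => fun s => f t x s
  end.

Definition coordinate i (t x y : R) : R :=
  match i with AT => t | AX => x | AY => y end.

(** Joint continuity of the function and of its derivative is bundled in, since differentiation
    under the integral and the fundamental theorem both require it; the closure lemmas below then
    carry it along for free. *)
Definition is_partial i f f' :=
  [/\ cont3 f, cont3 f' &
    forall t x y : R, is_derive (coordinate i t x y) 1 (slice i f t x y) (f' t x y)].

Lemma slice_coordinate i f (t x y : R) :
  slice i f t x y (coordinate i t x y) = f t x y.
Proof. by case: i. Qed.

Lemma cont3_cst (k : R) : cont3 (fun _ _ _ => k).
Proof. by move=> p; exact: cvg_cst. Qed.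

Lemma cont3_coordinate i : cont3 (coordinate i).
Proof.
case: i; last exact: continuous_snd.
- exact: (continuous_comp2 continuous_fst continuous_fst).
- exact: (continuous_comp2 continuous_fst continuous_snd).
Qed.

Lemma cont3D f g : cont3 f -> cont3 g -> cont3 (fun t x y => f t x y + g t x y).
Proof. by move=> cf cg p; apply: cvgD; [exact: cf|exact: cg]. Qed.

Lemma cont3N f : cont3 f -> cont3 (fun t x y => - f t x y).
Proof. by move=> cf p; apply: cvgN; exact: cf. Qed.

Lemma cont3M f g : cont3 f -> cont3 g -> cont3 (fun t x y => f t x y * g t x y).
Proof. by move=> cf cg p; apply: cvgM; [exact: cf|exact: cg]. Qed.

Lemma cont3X f n : cont3 f -> cont3 (fun t x y => f t x y ^+ n).
Proof.
move=> cf; exact: (continuous_comp2 cf (@exprn_continuous _ n)).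
Qed.

Lemma cont3_comp (phi : R -> R) f : continuous phi -> cont3 f ->
  cont3 (fun t x y => phi (f t x y)).
Proof.
move=> cphi cf p.
exact: (@cvg_comp _ _ _ (fun p : R * R * R => f p.1.1 p.1.2 p.2) phi _ _ _ (cf p) (cphi _)).
Qed.

Lemma cont3_subst f (a b c : R -> R -> R -> R) : cont3 f -> cont3 a -> cont3 b -> cont3 c ->
  cont3 (fun t x y => f (a t x y) (b t x y) (c t x y)).
Proof.
move=> cf ca cb cc.
exact: (continuous_comp2 (continuous_pair (continuous_pair ca cb) cc) cf).
Qed.

Lemma is_partial_eq i f f' f'' : is_partial i f f' ->
  (forall t x y, f' t x y = f'' t x y) -> is_partial i f f''.
Proof.
by move=> pf E; suff -> : f'' = f' by []; do 3 (apply/funext => ?); rewrite E.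
Qed.

Lemma is_partial_cst i (k : R) : is_partial i (fun _ _ _ => k) (fun _ _ _ => 0).
Proof.
split; try exact: cont3_cst.
by case: i => t x y /=; exact: is_derive_cst.
Qed.

Lemma is_partial_coordinate i j : is_partial i (coordinate j)
  (fun _ _ _ => match i, j with AT, AT | AX, AX | AY, AY => 1 | _, _ => 0 end).
Proof.
split; [exact: cont3_coordinate|exact: cont3_cst|].
by case: i; case: j => t x y /=; (exact: is_derive_cst || exact: is_derive_id).
Qed.

Lemma is_partialD i f f' g g' : is_partial i f f' -> is_partial i g g' ->
  is_partial i (fun t x y => f t x y + g t x y) (fun t x y => f' t x y + g' t x y).
Proof.
move=> [cf cf' df] [cg cg' dg]; split; try exact: cont3D.
move=> t x y; have := is_deriveD (df t x y) (dg t x y).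
by case: i {df dg}.
Qed.

Lemma is_partialN i f f' : is_partial i f f' ->
  is_partial i (fun t x y => - f t x y) (fun t x y => - f' t x y).
Proof.
move=> [cf cf' df]; split; try exact: cont3N.
move=> t x y; have := is_deriveN (df t x y).
by case: i {df}.
Qed.

Lemma is_partialM i f f' g g' : is_partial i f f' -> is_partial i g g' ->
  is_partial i (fun t x y => f t x y * g t x y)
    (fun t x y => f' t x y * g t x y + f t x y * g' t x y).
Proof.
move=> [cf cf' df] [cg cg' dg]; split.
- exact: cont3M.
- by apply: cont3D; exact: cont3M.
move=> t x y; have := is_deriveM (df t x y) (dg t x y).
rewrite !slice_coordinate /GRing.scale /= addrC (mulrC (g t x y)).
by case: i {df dg}.
Qed.

Lemma is_partialX2 i f f' : is_partial i f f' ->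
  is_partial i (fun t x y => f t x y ^+ 2) (fun t x y => 2 * f t x y * f' t x y).
Proof.
move=> pf; have := is_partialM pf pf.
under eq_fun do under eq_fun do under eq_fun do rewrite -expr2.
by move=> /is_partial_eq; apply => t x y; ring.
Qed.

Lemma is_partial_comp i (phi phi' : R -> R) f f' :
  (forall s : R, is_derive s 1 phi (phi' s)) -> continuous phi' ->
  is_partial i f f' ->
  is_partial i (fun t x y => phi (f t x y)) (fun t x y => phi' (f t x y) * f' t x y).
Proof.
move=> dphi cphi' [cf cf' df]; split.
- by apply: cont3_comp => //; exact: is_derive1_continuous dphi.
- by apply: cont3M => //; exact: cont3_comp.
move=> t x y.
have := @is_derive1_comp _ phi (slice i f t x y) (coordinate i t x y) _ _ (dphi _) (df t x y).
rewrite slice_coordinate.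
by case: i {df}.
Qed.

End partial_derivatives.

Section box_integral.
Context {R : realType}.
Implicit Types (f g : R -> R -> R -> R) (K t : R).

Definition int_box K f t : R :=
  int_cc (- K) K (fun x => int_cc (- K) K (f t x)).

Lemma cont3_section f t : cont3 f -> continuous (fun q : R * R => f t q.1 q.2).
Proof.
move=> cf.
have H : continuous (fun q : R * R => ((t, q.1), q.2)) :=
  continuous_pair (continuous_pair (@continuous_cst _ _ t) continuous_fst) continuous_snd.
exact: (continuous_comp2 H cf).
Qed.

Lemma cont3_section2 f t x : cont3 f -> continuous (f t x).
Proof. by move=> /(@cont3_section f t) => cf; exact: continuous_section. Qed.

Lemma cont3_int K f : 0 <= K -> cont3 f ->
  continuous (fun q : R * R => int_cc (- K) K (f q.1 q.2)).
Proof.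
move=> K0 cf; apply: (@continuous_param _ _ (fun q : R * R => f q.1 q.2)) => //.
lra.
Qed.

Lemma cont3_int_section K f t : 0 <= K -> cont3 f ->
  continuous (fun x => int_cc (- K) K (f t x)).
Proof.
move=> K0 cf.
exact: (@continuous_section _ _ _ (fun t x => int_cc (- K) K (f t x)) t (cont3_int K0 cf)).
Qed.

Lemma is_derive_int_box K f f' t : 0 <= K -> is_partial AT f f' ->
  is_derive t 1 (int_box K f) (int_box K f' t).
Proof.
move=> K0 [cf cf' df]; have KK : - K <= K by lra.
apply: (@is_derive_param _ (fun s x => int_cc (- K) K (f s x))
  (fun s x => int_cc (- K) K (f' s x))) => //.
- by move=> s; exact: cont3_int_section.
- exact: cont3_int.
move=> s x; apply: (@is_derive_param _ (fun s y => f s x y) (fun s y => f' s x y)) => //.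
- by move=> s'; exact: cont3_section2.
- have H : continuous (fun q : R * R => ((q.1, x), q.2)) :=
    continuous_pair (continuous_pair continuous_fst (@continuous_cst _ _ x)) continuous_snd.
  exact: (continuous_comp2 H cf').
Qed.

(** The order of integration is not exchanged: the inner [y]-integral is differentiated in [x] under
    the integral sign, and the outer integral is then computed by the fundamental theorem. *)
Lemma int_box_partialX K f f' t : 0 <= K -> is_partial AX f f' ->
  (forall y, f t K y = 0) -> (forall y, f t (- K) y = 0) -> int_box K f' t = 0.
Proof.
move=> K0 [cf cf' df] fK fNK; have KK : - K <= K by lra.
suff -> : int_box K f' t = int_cc (- K) K (f t K) - int_cc (- K) K (f t (- K)).
  by rewrite (@int_cc_eq0 _ _ _ (f t K))// (@int_cc_eq0 _ _ _ (f t (-K)))// subrr.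
apply: (@int_cc_FTC _ _ _ _ (fun x => int_cc (- K) K (f t x))) => //.
  exact: cont3_int_section.
move=> x; apply: is_derive_param => //.
- by move=> s; exact: cont3_section2.
- exact: cont3_section.
Qed.

Lemma int_box_partialY K f f' t : 0 <= K -> is_partial AY f f' ->
  (forall x, f t x K = 0) -> (forall x, f t x (- K) = 0) -> int_box K f' t = 0.
Proof.
move=> K0 [cf cf' df] fK fNK; have KK : - K <= K by lra.
rewrite /int_box int_cc_eq0// => x _.
suff -> : int_cc (- K) K (f' t x) = f t x K - f t x (- K) by rewrite fK fNK subrr.
apply: int_cc_FTC => //; first exact: cont3_section2.
by move=> y; exact: (df t x y).
Qed.

Lemma int_boxD K f g t : 0 <= K -> cont3 f -> cont3 g ->
  int_box K (fun t x y => f t x y + g t x y) t = int_box K f t + int_box K g t.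
Proof.
move=> K0 cf cg; rewrite /int_box -int_ccD; try exact: cont3_int_section.
by apply: eq_int_cc => x _; rewrite int_ccD//; exact: cont3_section2.
Qed.

Lemma int_boxZ K k f t : 0 <= K -> cont3 f ->
  int_box K (fun t x y => k * f t x y) t = k * int_box K f t.
Proof.
move=> K0 cf; rewrite /int_box -int_ccZ; try exact: cont3_int_section.
by apply: eq_int_cc => x _; rewrite int_ccZ//; exact: cont3_section2.
Qed.

Lemma eq_int_box K f g t :
  (forall x y, - K <= x <= K -> - K <= y <= K -> f t x y = g t x y) ->
  int_box K f t = int_box K g t.
Proof.
by move=> fg; apply: eq_int_cc => x Kx; apply: eq_int_cc => y Ky; exact: fg.
Qed.

Lemma le_int_box K f g t : 0 <= K -> cont3 f -> cont3 g ->
  (forall x y, - K <= x <= K -> - K <= y <= K -> f t x y <= g t x y) ->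
  int_box K f t <= int_box K g t.
Proof.
move=> K0 cf cg fg; apply: le_int_cc; try exact: cont3_int_section.
by move=> x Kx; apply: le_int_cc => [||y Ky]; [exact: cont3_section2..|exact: fg].
Qed.

Lemma int_box_eq0 K f t :
  (forall x y, - K <= x <= K -> - K <= y <= K -> f t x y = 0) -> int_box K f t = 0.
Proof. by move=> f0; apply: int_cc_eq0 => x Kx; apply: int_cc_eq0 => y; exact: f0. Qed.

Lemma int_box_ge0 K f t : 0 <= K -> cont3 f ->
  (forall x y, - K <= x <= K -> - K <= y <= K -> 0 <= f t x y) -> 0 <= int_box K f t.
Proof.
move=> K0 cf f0; rewrite -(@int_box_eq0 K (fun _ _ _ => 0) t)//.
by apply: le_int_box => //; exact: cont3_cst.
Qed.

Lemma int_box_le0_eq0 K f t : 0 <= K -> cont3 f ->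
  (forall x y, - K <= x <= K -> - K <= y <= K -> 0 <= f t x y) ->
  int_box K f t <= 0 -> forall x y, - K < x < K -> - K < y < K -> f t x y = 0.
Proof.
move=> K0 cf f0 If x y Kx Ky.
have f0x z : - K <= z <= K -> 0 <= int_cc (- K) K (f t z).
  by move=> Kz; apply: Rintegral_ge0 => w; rewrite /= in_itv => Kw; exact: f0.
have Ifx : int_cc (- K) K (f t x) = 0.
  exact: (@int_cc_gt0_eq0 _ (- K) K (fun x => int_cc (- K) K (f t x)) (cont3_int_section K0 cf) f0x If x Kx).
apply: (@int_cc_gt0_eq0 _ (- K) K (f t x)) => //; first exact: cont3_section2.
- by move=> z Kz; apply: f0 => //; case/andP: Kx => *; rewrite !ltW.
- by rewrite Ifx.
Qed.

(** Serves to replace a box that grows with the final time by a fixed one, for functions supported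
    in a disc. *)
Lemma int_box_supp K K' f t : 0 <= K' -> K' <= K -> cont3 f ->
  (forall x y, K' ^+ 2 <= x ^+ 2 + y ^+ 2 -> f t x y = 0) ->
  int_box K f t = int_box K' f t.
Proof.
move=> K'0 K'K cf f0; have K0 : 0 <= K by lra.
have out (x : R) : ~~ (- K' < x < K') -> K' ^+ 2 <= x ^+ 2.
  rewrite negb_and -!leNgt => /orP[h|h]; first by rewrite -[x ^+ 2]sqrrN ler_sqr ?nnegrE; lra.
  by rewrite ler_sqr ?nnegrE; lra.
rewrite /int_box (@int_cc_supp _ _ (- K') K' K); [|lra|lra|lra| |].
- apply: eq_int_cc => x _; apply: int_cc_supp; [lra|lra|lra|exact: cont3_section2|].
  by move=> y /out h; apply: f0; apply: (le_trans h); rewrite lerDr sqr_ge0.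
- exact: cont3_int_section.
move=> x /out h; apply: int_cc_eq0 => y _; apply: f0.
by apply: (le_trans h); rewrite lerDl sqr_ge0.
Qed.

End box_integral.

(** * Primitives in time *)

Section time_primitive.
Context {R : realType}.
Implicit Types (f g : R -> R -> R -> R).

(* The integral of f over [0, t], rescaled to a fixed interval so that only
   integrals with constant bounds have to be differentiated. *)
Definition primitive f (t x y : R) : R := t * int_cc 0 1 (fun s => f (t * s) x y).

Lemma primitive0 f x y : primitive f 0 x y = 0.
Proof. exact: mul0r. Qed.

Lemma is_partial_val i f f' (t x y : R) : is_partial i f f' ->
  is_derive (coordinate i t x y) 1 (slice i f t x y) (f' t x y).
Proof. by case. Qed.

Lemma cont3_line f x y : cont3 f -> continuous (fun t : R => f t x y).
Proof.
move=> cf.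
have H : continuous (fun t : R => ((t, x), y)) :=
  continuous_pair (continuous_pair (@continuous_idfun _) (@continuous_cst _ _ x)) (@continuous_cst _ _ y).
exact: (@continuous_comp2 _ _ _ _ _ H cf).
Qed.

Lemma cont3_scaled_line f t x y : cont3 f -> continuous (fun s : R => f (t * s) x y).
Proof.
move=> /(@cont3_line f x y) cf.
exact: (@continuous_comp2 _ _ _ _ _ (@mulrl_continuous _ t) cf).
Qed.

Lemma continuous_rescaled f : cont3 f ->
  continuous (fun q : R * R * R * R => f (q.1.1.1 * q.2) q.1.1.2 q.1.2).
Proof.
move=> cf.
have c1 : continuous (fun q : R * R * R * R => q.1.1) :=
  continuous_comp2 continuous_fst continuous_fst.
have c11 : continuous (fun q : R * R * R * R => q.1.1.1) := continuous_comp2 c1 continuous_fst.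
have c12 : continuous (fun q : R * R * R * R => q.1.1.2) := continuous_comp2 c1 continuous_snd.
have c2 : continuous (fun q : R * R * R * R => q.1.2) :=
  continuous_comp2 continuous_fst continuous_snd.
have c3 : continuous (fun q : R * R * R * R => q.2) := continuous_snd.
have cm : continuous (fun q : R * R * R * R => q.1.1.1 * q.2).
  by move=> q; apply: cvgM; [exact: c11|exact: c3].
have H : continuous (fun q : R * R * R * R => ((q.1.1.1 * q.2, q.1.1.2), q.1.2)) :=
  continuous_pair (continuous_pair cm c12) c2.
exact: (@continuous_comp2 _ _ _ _ _ H cf).
Qed.

Lemma cont3_primitive f : cont3 f -> cont3 (primitive f).
Proof.
move=> cf; apply: cont3M; first exact: (@cont3_coordinate _ AT).
apply: (@continuous_param _ _ (fun (q : R * R * R) s => f (q.1.1 * s) q.1.2 q.2)) => //.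
exact: continuous_rescaled.
Qed.

Lemma is_derive_scale (F : R -> R) (t s d : R) : is_derive (t * s) 1 F d ->
  is_derive t 1 (fun t => F (t * s)) (s * d).
Proof.
move=> dF.
have dm : is_derive t 1 (fun t : R => t * s) s.
  have := is_deriveM (is_derive_id t (1 : R)) (is_derive_cst s t (1 : R)).
  by rewrite scaler0 add0r /GRing.scale /= mulr1.
rewrite mulrC; exact: (@is_derive1_comp _ F (fun t => t * s) t _ _ dF dm).
Qed.

Lemma is_partial_primitive f f0 : is_partial AT f f0 -> is_partial AT (primitive f) f.
Proof.
move=> pf; have [cf cf0 df] := pf; split => //; first exact: cont3_primitive.
move=> t x y /=.
have d1 : is_derive t 1 (fun t => int_cc 0 1 (fun s => f (t * s) x y))
    (int_cc 0 1 (fun s => s * f0 (t * s) x y)).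
  apply: (@is_derive_param _ (fun t s => f (t * s) x y) (fun t s => s * f0 (t * s) x y)) => //.
  - by move=> s; exact: cont3_scaled_line.
  - have cm : continuous (fun q : R * R => q.1 * q.2).
      by move=> q; apply: cvgM; [exact: cvg_fst|exact: cvg_snd].
    have H : continuous (fun q : R * R => f0 (q.1 * q.2) x y).
      exact: (@continuous_comp2 _ _ _ (fun q : R * R => q.1 * q.2) (fun t => f0 t x y) cm
        (@cont3_line f0 x y cf0)).
    by move=> q; apply: cvgM; [exact: cvg_snd|exact: H].
  - by move=> t' s; apply: (@is_derive_scale (fun t => f t x y)); exact: (df (t' * s) x y).
have := is_deriveM (is_derive_id t (1 : R)) d1.
have -> : t *: int_cc 0 1 (fun s => s * f0 (t * s) x y) +
    int_cc 0 1 (fun s => f (t * s) x y) *: 1 = f t x y; last by [].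
rewrite /GRing.scale /= mulr1.
have c1 : continuous (fun s : R => s * f0 (t * s) x y).
  by move=> s; apply: cvgM; [exact: cvg_id|exact: cont3_scaled_line].
have c2 : continuous (fun s : R => t * (s * f0 (t * s) x y)).
  by move=> s; apply: cvgM; [exact: cvg_cst|exact: c1].
rewrite -int_ccZ// -int_ccD//; last exact: cont3_scaled_line.
(* The integrand [t s f0 (t s) + f (t s)] is the derivative of [s f (t s)] in [s]. *)
transitivity (1 * f (t * 1) x y - 0 * f (t * 0) x y); last by rewrite mulr1; ring.
apply: (@int_cc_FTC _ 0 1 _ (fun s => s * f (t * s) x y)) => //.
  by move=> s; apply: cvgD; [exact: c2|exact: cont3_scaled_line].
move=> s.
have dl : is_derive s 1 (fun s => f (t * s) x y) (t * f0 (t * s) x y).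
  under eq_fun do rewrite mulrC; apply: (@is_derive_scale (fun t => f t x y)).
  by rewrite mulrC; exact: (df (t * s) x y).
have := is_deriveM (is_derive_id s (1 : R)) dl.
by rewrite /GRing.scale /= mulr1 mulrCA.
Qed.

Lemma is_partial_primitiveX f f1 : is_partial AX f f1 ->
  is_partial AX (primitive f) (primitive f1).
Proof.
move=> [cf cf1 df]; split; try exact: cont3_primitive.
move=> t x y /=.
have d1 : is_derive x 1 (fun x => int_cc 0 1 (fun s => f (t * s) x y))
    (int_cc 0 1 (fun s => f1 (t * s) x y)).
  apply: (@is_derive_param _ (fun x s => f (t * s) x y) (fun x s => f1 (t * s) x y)) => //.
  - by move=> s; exact: cont3_scaled_line.
  - have cm : continuous (fun q : R * R => t * q.2).
      by move=> q; apply: cvgM; [exact: cvg_cst|exact: cvg_snd].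
    have H : continuous (fun q : R * R => ((t * q.2, q.1), y)) :=
      continuous_pair (continuous_pair cm continuous_fst) (@continuous_cst _ _ y).
    exact: (@continuous_comp2 _ _ _ _ _ H cf1).
have := is_deriveM (is_derive_cst t x (1 : R)) d1.
by rewrite scaler0 addr0.
Qed.

Lemma is_partial_primitiveY f f2 : is_partial AY f f2 ->
  is_partial AY (primitive f) (primitive f2).
Proof.
move=> [cf cf2 df]; split; try exact: cont3_primitive.
move=> t x y /=.
have d1 : is_derive y 1 (fun y => int_cc 0 1 (fun s => f (t * s) x y))
    (int_cc 0 1 (fun s => f2 (t * s) x y)).
  apply: (@is_derive_param _ (fun y s => f (t * s) x y) (fun y s => f2 (t * s) x y)) => //.
  - by move=> s; exact: cont3_scaled_line.
  - have cm : continuous (fun q : R * R => t * q.2).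
      by move=> q; apply: cvgM; [exact: cvg_cst|exact: cvg_snd].
    have H : continuous (fun q : R * R => ((t * q.2, x), q.1)) :=
      continuous_pair (continuous_pair cm (@continuous_cst _ _ x)) continuous_fst.
    exact: (@continuous_comp2 _ _ _ _ _ H cf2).
have := is_deriveM (is_derive_cst t y (1 : R)) d1.
by rewrite scaler0 addr0.
Qed.

Lemma is_partial_primitive_space i f f' : i <> AT -> is_partial i f f' ->
  is_partial i (primitive f) (primitive f').
Proof.
by case: i => // _; [exact: is_partial_primitiveX|exact: is_partial_primitiveY].
Qed.

Lemma primitiveE f f0 f00 t x y : is_partial AT f f0 -> is_partial AT f0 f00 ->
  f t x y = f 0 x y + primitive f0 t x y.
Proof.
move=> pf pf0; apply/eqP; rewrite -subr_eq; apply/eqP.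
transitivity (f 0 x y - primitive f0 0 x y); last by rewrite primitive0 subr0.
apply: (@is_derive_0_is_cst _ (fun t => f t x y - primitive f0 t x y)) => s.
have := is_deriveB (is_partial_val s x y pf) (is_partial_val s x y (is_partial_primitive pf0)).
by rewrite subrr.
Qed.

(* Writing f(t) = f(0) + (primitive of f0)(t) and differentiating in space
   under the integral sign reduces the symmetry of mixed second derivatives to
   the fundamental theorem of calculus. *)
Lemma mixed_partials i f f0 f00 f' f0' f0'0 : i <> AT ->
  is_partial AT f f0 -> is_partial AT f0 f00 ->
  is_partial i f f' -> is_partial i f0 f0' -> is_partial AT f0' f0'0 ->
  is_partial AT f' f0'.
Proof.
move=> iT pf pf0 pfi pf0i pf0i0; have [_ cf' _] := pfi.
have E t x y : f' t x y = f' 0 x y + primitive f0' t x y.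
  have [_ dfi] := is_partial_val t x y pfi.
  have d0 := is_partial_val 0 x y pfi.
  have dp := is_partial_val t x y (is_partial_primitive_space iT pf0i).
  case: i iT {pfi pf0i} dfi d0 dp => //= _ <- [d0 <-] [dp <-].
  - rewrite -deriveD//; congr (derive _ _ _); apply/funext => s.
    exact: (primitiveE t s y pf pf0).
  - rewrite -deriveD//; congr (derive _ _ _); apply/funext => s.
    exact: (primitiveE t x s pf pf0).
have [cf0' _ dp] := is_partial_primitive pf0i0.
split => //; first by case: pf0i0.
move=> t x y.
have -> : slice AT f' t x y = fun s => f' 0 x y + primitive f0' s x y.
  by apply/funext => s /=; exact: E.
have := is_deriveD (is_derive_cst (f' 0 x y) t (1 : R)) (dp t x y).
by rewrite add0r.
Qed.

End time_primitive.

(** * Jets of smooth functions *)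

Lemma is_derive1_cvg (R : realType) (f : R -> R) (x d : R) :
  (fun h : R => h^-1 * (f (h + x) - f x)) @ 0^' --> d -> is_derive x 1 f d.
Proof.
move=> /cvgrPdist_le H; apply/is_derive1_epsP => e e0.
by move: (H e e0); apply: filterS => h; rewrite distrC.
Qed.

Section smooth_curried.
Context {R : realType}.
Implicit Types (f : R -> R -> R -> R).

Definition partial i f (t x y : R) : R := 'D_1 (slice i f t x y) (coordinate i t x y).

Fixpoint smooth3 n f : Prop :=
  if n is n'.+1 then
    forall i, is_partial i f (partial i f) /\ smooth3 n' (partial i f)
  else cont3 f.

Definition axis_vector i : R * (R * R) :=
  match i with AT => (1, (0, 0)) | AX => (0, (1, 0)) | AY => (0, (0, 1)) end.

Lemma scale_axis_vectorD i (h t x y : R) : h *: axis_vector i + (t, (x, y)) =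
  match i with AT => (h + t, (x, y)) | AX => (t, (h + x, y)) | AY => (t, (x, h + y)) end.
Proof.
have E a b c : h *: (a, (b, c)) + (t, (x, y)) = (h * a + t, (h * b + x, h * c + y)) by [].
by case: i; rewrite /axis_vector E ?mulr1 !mulr0 !add0r.
Qed.

(** [pi] stands for either component projection; difference quotients only require it to commute
    with scaled differences. *)
Lemma is_derive_slice i (pi : R * R -> R) (w : R * (R * R) -> R * R) (t x y : R) :
  continuous pi -> (forall k a b, pi (k *: (a - b)) = k * (pi a - pi b)) ->
  derivable w (t, (x, y)) (axis_vector i) ->
  is_derive (coordinate i t x y) 1 (slice i (fun t x y => pi (w (t, (x, y)))) t x y)
    (pi ('D_(axis_vector i) w (t, (x, y)))).
Proof.
move=> cpi linpi dw; apply: is_derive1_cvg.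
have := cvg_comp _ _ dw (cpi _); apply: cvg_trans; apply: near_eq_cvg.
apply: nearW => h /=; rewrite linpi.
rewrite scale_axis_vectorD.
by case: i {dw}.
Qed.

Lemma cont3_comp_smooth (pi : R * R -> R) (w : R * (R * R) -> R * R) :
  continuous pi -> continuous w -> cont3 (fun t x y => pi (w (t, (x, y)))).
Proof.
move=> cpi cw.
have c1 : continuous (fun p : R * R * R => p.1.1) :=
  continuous_comp2 continuous_fst continuous_fst.
have c2 : continuous (fun p : R * R * R => p.1.2) :=
  continuous_comp2 continuous_fst continuous_snd.
have H : continuous (fun p : R * R * R => (p.1.1, (p.1.2, p.2))) :=
  continuous_pair c1 (continuous_pair c2 continuous_snd).
exact: (@continuous_comp2 _ _ _ _ _ (@continuous_comp2 _ _ _ _ _ H cw) cpi).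
Qed.

Lemma Ck_continuous n (w : R * (R * R) -> R * R) : Ck n w -> continuous w.
Proof. by case: n => // n [dw _] p; exact: differentiable_continuous. Qed.

Lemma smooth3_Ck n (pi : R * R -> R) (w : R * (R * R) -> R * R) :
  continuous pi -> (forall k a b, pi (k *: (a - b)) = k * (pi a - pi b)) ->
  Ck n w -> smooth3 n (fun t x y => pi (w (t, (x, y)))).
Proof.
move=> cpi linpi; elim: n w => [|n IH] w; first exact: cont3_comp_smooth.
move=> /[dup] /Ck_continuous cw [dw Dw] i.
have E : partial i (fun t x y => pi (w (t, (x, y)))) =
    fun t x y => pi ('D_(axis_vector i) w (t, (x, y))).
  apply/funext => t; apply/funext => x; apply/funext => y; rewrite /partial.
  have Dp := @diff_derivable _ _ _ w (t, (x, y)) (axis_vector i) (dw (t, (x, y))).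
  by have [_ ->] := is_derive_slice cpi linpi Dp.
split; last by rewrite E; exact: (IH _ (Dw (axis_vector i))).
rewrite E; split.
- exact: (cont3_comp_smooth cpi cw).
- exact: (cont3_comp_smooth cpi (Ck_continuous (Dw (axis_vector i)))).
- by move=> t x y; apply: is_derive_slice => //; exact: diff_derivable.
Qed.

(** The derivatives up to order two are fields of their own rather than computed from [j_]: for a
    time primitive they are primitives of derivatives or derivatives of the original function, and
    the identities below then hold for both kinds of jets by polynomial algebra. *)
Record jet := Jet { j_ : R -> R -> R -> R;
  jt : R -> R -> R -> R; jx : R -> R -> R -> R; jy : R -> R -> R -> R;
  jtt : R -> R -> R -> R; jtx : R -> R -> R -> R; jty : R -> R -> R -> R;
  jxx : R -> R -> R -> R; jxy : R -> R -> R -> R;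
  jyx : R -> R -> R -> R; jyy : R -> R -> R -> R }.

(* jyx is the x-derivative of jy; jtx and jty are both the space derivatives of
   jt and the time derivatives of jx and jy. *)
Record is_jet (j : jet) : Prop := IsJet {
  jet_t : is_partial AT (j_ j) (jt j);
  jet_x : is_partial AX (j_ j) (jx j);
  jet_y : is_partial AY (j_ j) (jy j);
  jet_tt : is_partial AT (jt j) (jtt j);
  jet_tx : is_partial AX (jt j) (jtx j);
  jet_ty : is_partial AY (jt j) (jty j);
  jet_xt : is_partial AT (jx j) (jtx j);
  jet_xx : is_partial AX (jx j) (jxx j);
  jet_xy : is_partial AY (jx j) (jxy j);
  jet_yt : is_partial AT (jy j) (jty j);
  jet_yx : is_partial AX (jy j) (jyx j);
  jet_yy : is_partial AY (jy j) (jyy j) }.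

Definition jet_of f := Jet f (partial AT f) (partial AX f) (partial AY f)
  (partial AT (partial AT f)) (partial AX (partial AT f)) (partial AY (partial AT f))
  (partial AX (partial AX f)) (partial AY (partial AX f))
  (partial AX (partial AY f)) (partial AY (partial AY f)).

Definition jet_primitive f := Jet (primitive f) f
  (primitive (partial AX f)) (primitive (partial AY f))
  (partial AT f) (partial AX f) (partial AY f)
  (primitive (partial AX (partial AX f))) (primitive (partial AY (partial AX f)))
  (primitive (partial AX (partial AY f))) (primitive (partial AY (partial AY f))).

Lemma is_jet_of f : smooth3 3 f -> is_jet (jet_of f).
Proof.
move=> sf.
have [pt st] := sf AT; have [px sx] := sf AX; have [py sy] := sf AY.
have [ptt stt] := st AT; have [ptx stx] := st AX; have [pty sty] := st AY.
have [ptxt _] := stx AT; have [ptyt _] := sty AT.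
have [pxx _] := sx AX; have [pxy _] := sx AY.
have [pyx _] := sy AX; have [pyy _] := sy AY.
have XT : AX <> AT by []. have YT : AY <> AT by [].
have pxt : is_partial AT (partial AX f) (partial AX (partial AT f)).
  exact: (@mixed_partials _ AX _ _ _ _ _ _ XT pt ptt px ptx ptxt).
have pyt : is_partial AT (partial AY f) (partial AY (partial AT f)).
  exact: (@mixed_partials _ AY _ _ _ _ _ _ YT pt ptt py pty ptyt).
exact: (@IsJet (jet_of f) pt px py ptt ptx pty pxt pxx pxy pyt pyx pyy).
Qed.

Lemma is_jet_primitive f : smooth3 3 f -> is_jet (jet_primitive f).
Proof.
move=> sf.
have [pt st] := sf AT; have [px sx] := sf AX; have [py sy] := sf AY.
have [pxt _] := sx AT; have [pxx _] := sx AX; have [pxy _] := sx AY.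
have [pyt _] := sy AT; have [pyx _] := sy AX; have [pyy _] := sy AY.
exact: (@IsJet (jet_primitive f)
  (is_partial_primitive pt) (is_partial_primitiveX px) (is_partial_primitiveY py) pt px py
  (is_partial_primitive pxt) (is_partial_primitiveX pxx) (is_partial_primitiveY pxy)
  (is_partial_primitive pyt) (is_partial_primitiveX pyx) (is_partial_primitiveY pyy)).
Qed.

End smooth_curried.

(** * Energy identities *)

(** Differentiates by recursion on the shape of the function, leaving the derivative as an
    existential variable; [is_partial_eq] then leaves an algebraic identity to check. *)
Ltac partial_of :=
  lazymatch goal with
  | |- is_partial ?i (fun t x y => @?f t x y + @?g t x y) _ =>
      apply: (@is_partialD _ i f _ g _); [partial_of|partial_of]
  | |- is_partial ?i (fun t x y => - @?f t x y) _ =>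
      apply: (@is_partialN _ i f _); partial_of
  | |- is_partial ?i (fun t x y => @?f t x y ^+ 2) _ =>
      apply: (@is_partialX2 _ i f _); partial_of
  | |- is_partial ?i (fun t x y => @?f t x y * @?g t x y) _ =>
      apply: (@is_partialM _ i f _ g _); [partial_of|partial_of]
  | |- is_partial ?i (fun t x y => ?f t x y) _ =>
      first [ match goal with H : is_partial i f _ |- _ => exact H end
            | eassumption | apply: is_partial_cst ]
  | _ => first [eassumption | apply: is_partial_cst]
  end.

Section energy_identities.
Context {R : realType}.
(* a2 and e stand for a^2 and b^2 - a^2. *)
Variables (a2 e : R) (u v : jet (R := R)).
Hypotheses (ju : is_jet u) (jv : is_jet v).

Definition elastic1 (t x y : R) : R :=
  a2 * (jxx u t x y + jyy u t x y) + e * (jxx u t x y + jyx v t x y).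
Definition elastic2 (t x y : R) : R :=
  a2 * (jxx v t x y + jyy v t x y) + e * (jxy u t x y + jyy v t x y).

Definition kinetic (t x y : R) : R := jt u t x y ^+ 2 + jt v t x y ^+ 2.
Definition potential (t x y : R) : R :=
  a2 * (jx u t x y ^+ 2 + jy u t x y ^+ 2 + (jx v t x y ^+ 2 + jy v t x y ^+ 2))
  + e * (jx u t x y + jy v t x y) ^+ 2.
Definition density (t x y : R) : R := 2^-1 * (kinetic t x y + potential t x y).

(* The components of the stress tensor of (u, v) applied to the vector (p, q). *)
Definition fluxX (p q : R -> R -> R -> R) (t x y : R) : R :=
  a2 * (jx u t x y * p t x y + jx v t x y * q t x y)
  + e * ((jx u t x y + jy v t x y) * p t x y).
Definition fluxY (p q : R -> R -> R -> R) (t x y : R) : R :=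
  a2 * (jy u t x y * p t x y + jy v t x y * q t x y)
  + e * ((jx u t x y + jy v t x y) * q t x y).

Definition fluxX' (p q px qx : R -> R -> R -> R) (t x y : R) : R :=
  a2 * (jxx u t x y * p t x y + jx u t x y * px t x y
        + (jxx v t x y * q t x y + jx v t x y * qx t x y))
  + e * ((jxx u t x y + jyx v t x y) * p t x y + (jx u t x y + jy v t x y) * px t x y).
Definition fluxY' (p q py qy : R -> R -> R -> R) (t x y : R) : R :=
  a2 * (jyy u t x y * p t x y + jy u t x y * py t x y
        + (jyy v t x y * q t x y + jy v t x y * qy t x y))
  + e * ((jxy u t x y + jyy v t x y) * q t x y + (jx u t x y + jy v t x y) * qy t x y).

Lemma is_partial_fluxX p q px qx : is_partial AX p px -> is_partial AX q qx ->
  is_partial AX (fluxX p q) (fluxX' p q px qx).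
Proof.
case: ju => ? ? ? ? ? ? ? ? ? ? ? ?; case: jv => ? ? ? ? ? ? ? ? ? ? ? ? pp pq.
by apply: is_partial_eq; [rewrite /fluxX; partial_of|rewrite /fluxX' => t x y /=; ring].
Qed.

Lemma is_partial_fluxY p q py qy : is_partial AY p py -> is_partial AY q qy ->
  is_partial AY (fluxY p q) (fluxY' p q py qy).
Proof.
case: ju => ? ? ? ? ? ? ? ? ? ? ? ?; case: jv => ? ? ? ? ? ? ? ? ? ? ? ? pp pq.
by apply: is_partial_eq; [rewrite /fluxY; partial_of|rewrite /fluxY' => t x y /=; ring].
Qed.

(** Multiplier [u_t], with no equation assumed. The residual [jtt - elastic] is later replaced by
    [- V u_t] for the solution and by [F - V u] for its time primitive. *)
Lemma is_partial_density : is_partial AT density (fun t x y =>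
  jt u t x y * (jtt u t x y - elastic1 t x y) + jt v t x y * (jtt v t x y - elastic2 t x y)
  + fluxX' (jt u) (jt v) (jtx u) (jtx v) t x y + fluxY' (jt u) (jt v) (jty u) (jty v) t x y).
Proof.
case: ju => ? ? ? ? ? ? ? ? ? ? ? ?; case: jv => ? ? ? ? ? ? ? ? ? ? ? ?.
apply: is_partial_eq; first by rewrite /density /kinetic /potential; partial_of.
by move=> t x y /=; rewrite /fluxX' /fluxY' /elastic1 /elastic2; field.
Qed.

Definition virial (t x y : R) : R :=
  j_ u t x y * jt u t x y + j_ v t x y * jt v t x y.

(** Multiplier [u]: up to flux and residual, the derivative compares kinetic with potential energy,
    which is what lets the weighted energy trade one for the other. *)
Lemma is_partial_virial : is_partial AT virial (fun t x y =>
  kinetic t x y - potential t x y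
  + j_ u t x y * (jtt u t x y - elastic1 t x y) + j_ v t x y * (jtt v t x y - elastic2 t x y)
  + fluxX' (j_ u) (j_ v) (jx u) (jx v) t x y + fluxY' (j_ u) (j_ v) (jy u) (jy v) t x y).
Proof.
case: ju => ? ? ? ? ? ? ? ? ? ? ? ?; case: jv => ? ? ? ? ? ? ? ? ? ? ? ?.
apply: is_partial_eq; first by rewrite /virial; partial_of.
by move=> t x y /=; rewrite /kinetic /potential /fluxX' /fluxY' /elastic1 /elastic2; ring.
Qed.

End energy_identities.

Lemma is_partial_cont3 (R : realType) i (f f' : R -> R -> R -> R) : is_partial i f f' -> cont3 f.
Proof. by case. Qed.

Lemma is_partial_cont3' (R : realType) i (f f' : R -> R -> R -> R) : is_partial i f f' -> cont3 f'.
Proof. by case. Qed.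

Ltac cont3_of :=
  lazymatch goal with
  | |- cont3 (fun t x y => @?f t x y + @?g t x y) => apply: (@cont3D _ f g); cont3_of
  | |- cont3 (fun t x y => - @?f t x y) => apply: (@cont3N _ f); cont3_of
  | |- cont3 (fun t x y => @?f t x y ^+ ?n) => apply: (@cont3X _ f n); cont3_of
  | |- cont3 (fun t x y => @?f t x y * @?g t x y) => apply: (@cont3M _ f g); cont3_of
  | |- cont3 (fun t x y => ?f t x y) =>
      first [ match goal with H : cont3 f |- _ => exact H end | eassumption | apply: cont3_cst ]
  | _ => first [eassumption | apply: cont3_cst]
  end.

Section box_identities.
Context {R : realType}.
Variables (a2 e : R) (u v : jet (R := R)).
Hypotheses (ju : is_jet u) (jv : is_jet v).

Lemma cont3_kinetic : cont3 (kinetic u v).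
Proof.
have := is_partial_cont3 (jet_tt ju); have := is_partial_cont3 (jet_tt jv).
by move=> *; rewrite /kinetic; cont3_of.
Qed.

Lemma cont3_potential : cont3 (potential a2 e u v).
Proof.
have := is_partial_cont3 (jet_xx ju); have := is_partial_cont3 (jet_xx jv).
have := is_partial_cont3 (jet_yx ju); have := is_partial_cont3 (jet_yx jv).
by move=> *; rewrite /potential; cont3_of.
Qed.

Lemma cont3_elastic1 : cont3 (elastic1 a2 e u v).
Proof.
have := is_partial_cont3' (jet_xx ju); have := is_partial_cont3' (jet_yx jv).
have := is_partial_cont3' (jet_yy ju).
by move=> *; rewrite /elastic1; cont3_of.
Qed.

Lemma cont3_elastic2 : cont3 (elastic2 a2 e u v).
Proof.
have := is_partial_cont3' (jet_xx jv); have := is_partial_cont3' (jet_xy ju).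
have := is_partial_cont3' (jet_yy jv).
by move=> *; rewrite /elastic2; cont3_of.
Qed.

Definition vanishes K (f : R -> R -> R -> R) t :=
  forall x y, K ^+ 2 <= x ^+ 2 + y ^+ 2 -> f t x y = 0.

(** The fluxes are linear in [(p, q)], and the boundary of the square lies outside the open disc of
    radius [K], where [p] and [q] vanish. *)
Lemma int_box_flux K p q px qx py qy t : 0 <= K ->
  is_partial AX p px -> is_partial AX q qx -> is_partial AY p py -> is_partial AY q qy ->
  vanishes K p t -> vanishes K q t ->
  int_box K (fluxX' a2 e u v p q px qx) t + int_box K (fluxY' a2 e u v p q py qy) t = 0.
Proof.
move=> K0 ppx pqx ppy pqy p0 q0.
have hX y : K ^+ 2 <= K ^+ 2 + y ^+ 2 by rewrite lerDl sqr_ge0.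
have hY x : K ^+ 2 <= x ^+ 2 + K ^+ 2 by rewrite lerDr sqr_ge0.
rewrite (int_box_partialX K0 (is_partial_fluxX a2 e ju jv ppx pqx)).
- rewrite (int_box_partialY K0 (is_partial_fluxY a2 e ju jv ppy pqy)) ?addr0// => x.
  + by rewrite /fluxY p0 ?q0 ?sqrrN// !mulr0 !addr0 mulr0.
  + by rewrite /fluxY p0 ?q0 ?sqrrN// !mulr0 !addr0 mulr0.
- by move=> y; rewrite /fluxX p0 ?q0 ?sqrrN// !mulr0 !addr0 mulr0.
- by move=> y; rewrite /fluxX p0 ?q0 ?sqrrN// !mulr0 !addr0 mulr0.
Qed.

Lemma is_derive_energy K t : 0 <= K -> vanishes K (jt u) t -> vanishes K (jt v) t ->
  is_derive t 1 (int_box K (density a2 e u v)) (int_box K (fun t x y =>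
    jt u t x y * (jtt u t x y - elastic1 a2 e u v t x y)
    + jt v t x y * (jtt v t x y - elastic2 a2 e u v t x y)) t).
Proof.
move=> K0 u0 v0.
have := is_derive_int_box t K0 (is_partial_density a2 e ju jv).
have cX := is_partial_cont3' (is_partial_fluxX a2 e ju jv (jet_tx ju) (jet_tx jv)).
have cY := is_partial_cont3' (is_partial_fluxY a2 e ju jv (jet_ty ju) (jet_ty jv)).
have c1 := is_partial_cont3 (jet_tt ju); have c2 := is_partial_cont3 (jet_tt jv).
have c3 := is_partial_cont3' (jet_tt ju); have c4 := is_partial_cont3' (jet_tt jv).
have c5 := cont3_elastic1; have c6 := cont3_elastic2.
rewrite int_boxD//; last by cont3_of.
rewrite int_boxD//; last by cont3_of.
rewrite -addrA [X in _ + X](int_box_flux K0 (jet_tx ju) (jet_tx jv) (jet_ty ju) (jet_ty jv) u0 v0).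
by rewrite addr0.
Qed.

Lemma is_derive_virial K t : 0 <= K -> vanishes K (j_ u) t -> vanishes K (j_ v) t ->
  is_derive t 1 (int_box K (virial u v)) (int_box K (fun t x y =>
    kinetic u v t x y - potential a2 e u v t x y
    + j_ u t x y * (jtt u t x y - elastic1 a2 e u v t x y)
    + j_ v t x y * (jtt v t x y - elastic2 a2 e u v t x y)) t).
Proof.
move=> K0 u0 v0.
have := is_derive_int_box t K0 (is_partial_virial a2 e ju jv).
have cX := is_partial_cont3' (is_partial_fluxX a2 e ju jv (jet_x ju) (jet_x jv)).
have cY := is_partial_cont3' (is_partial_fluxY a2 e ju jv (jet_y ju) (jet_y jv)).
have c1 := is_partial_cont3 (jet_t ju); have c2 := is_partial_cont3 (jet_t jv).
have c3 := is_partial_cont3' (jet_tt ju); have c4 := is_partial_cont3' (jet_tt jv).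
have c5 := cont3_elastic1; have c6 := cont3_elastic2.
have c7 := cont3_kinetic; have c8 := cont3_potential.
rewrite int_boxD//; last by cont3_of.
rewrite int_boxD//; last by cont3_of.
rewrite -addrA [X in _ + X](int_box_flux K0 (jet_x ju) (jet_x jv) (jet_y ju) (jet_y jv) u0 v0).
by rewrite addr0.
Qed.

End box_identities.

Section positive_part.
Context {R : realType}.

(** The square makes the truncation at 0 continuously differentiable, as [is_partial_comp] demands.
    It is used both for the cone cut-off and for the Hardy weight. *)
Definition pos_sq (s : R) : R := Num.max s 0 ^+ 2.

Lemma is_derive_pos_sq (s : R) : is_derive s 1 pos_sq (2 * Num.max s 0).
Proof.
have [s0|s0|->] := ltrgtP s 0.
- rewrite mulr0; apply: (@near_eq_is_derive _ _ _ (fun=> 0)) => //.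
  near=> z; rewrite /pos_sq max_r ?expr0n//.
  by apply: ltW; near: z; exact: lt_nbhsl.
- have H : is_derive s 1 (fun z : R => z ^+ 2) (2 * s).
    have := is_deriveM (is_derive_id s (1 : R)) (is_derive_id s (1 : R)).
    by rewrite /GRing.scale /= !mulr1 (_ : 2 * s = s + s)//; ring.
  apply: near_eq_is_derive H.
  near=> z; rewrite /pos_sq max_l//.
  by apply: ltW; near: z; exact: lt_nbhsr.
- rewrite mulr0; apply/is_derive1_epsP => e e0.
  exists e => //= h; rewrite /ball /= sub0r normrN => he h0.
  rewrite /pos_sq addr0 maxxx expr0n /= !subr0 normrM.
  have -> : `|Num.max h 0 ^+ 2| = Num.max h 0 ^+ 2 by rewrite ger0_norm ?sqr_ge0.
  have hp : 0 < `|h| by rewrite normr_gt0.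
  rewrite normfV ler_pdivrMl//.
  have : Num.max h 0 ^+ 2 <= `|h| ^+ 2.
    have [hh|hh] := leP h 0; first by rewrite expr0n/= sqr_ge0.
    by rewrite real_normK ?num_real.
  nra.
Unshelve. all: by end_near. Qed.

Lemma continuous_pos_sq' : continuous (fun s : R => 2 * Num.max s 0).
Proof.
move=> s; apply: cvgM; first exact: cvg_cst.
by apply: continuous_max; [exact: cvg_id|exact: cvg_cst].
Qed.

End positive_part.

(** * Finite speed of propagation *)

Ltac nonneg :=
  lazymatch goal with
  | |- is_true (0 <= _ + _) => apply: addr_ge0; nonneg
  | |- is_true (0 <= _ ^+ 2) => exact: sqr_ge0
  | |- is_true (0 <= _ * _) => apply: mulr_ge0; nonneg
  | |- is_true (0 <= _ ^-1) => rewrite invr_ge0; nonneg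
  | _ => try by []
  end.

Lemma is_derive_le0_nincr (R : realType) (f f' : R -> R) (a b : R) :
  a <= b -> (forall t : R, is_derive t 1 f (f' t)) ->
  (forall t, a < t < b -> f' t <= 0) -> f b <= f a.
Proof.
move=> ab df f'0.
apply: (@ler0_derive1_nincr _ f a b) => //.
- move=> x; rewrite in_itv /= => xab.
  by rewrite derive1E; case: (df x) => _ ->; exact: f'0.
- by apply: continuous_subspaceT; exact: is_derive1_continuous df.
Qed.

Lemma int_box_divergence_le0 (R : realType) K (f F F' G G' : R -> R -> R -> R) t :
  0 <= K -> is_partial AX F F' -> is_partial AY G G' -> cont3 f ->
  (forall y, F t K y = 0) -> (forall y, F t (- K) y = 0) ->
  (forall x, G t x K = 0) -> (forall x, G t x (- K) = 0) ->
  (forall x y, - K <= x <= K -> - K <= y <= K -> f t x y <= F' t x y + G' t x y) ->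
  int_box K f t <= 0.
Proof.
move=> K0 pF pG cf F1 F2 G1 G2 H.
have cF := is_partial_cont3' pF; have cG := is_partial_cont3' pG.
have -> : 0 = int_box K (fun t x y => F' t x y + G' t x y) t.
  by rewrite int_boxD// (int_box_partialX K0 pF)// (int_box_partialY K0 pG)// addr0.
by apply: le_int_box => //; exact: cont3D.
Qed.

Section cone_weight.
Context {R : realType}.
Variables (b x0 y0 R0 : R).

Definition cone_arg (t x y : R) : R :=
  (R0 + (- b) * t) ^+ 2 + - ((x + - x0) ^+ 2 + (y + - y0) ^+ 2).
(* The cut-off ((R0 - b t)^2 - |x - x0|^2)_+^2 is of class C^1 and, while
   R0 - b t > 0, satisfies psi_t + b |grad psi| <= 0. *)
Definition cone_weight (t x y : R) : R := pos_sq (cone_arg t x y).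
Definition cone_weight' (t x y : R) : R := 2 * Num.max (cone_arg t x y) 0.

Lemma is_partialT_cone_weight :
  is_partial AT cone_weight (fun t x y => cone_weight' t x y * (- (2 * b * (R0 - b * t)))).
Proof.
have pt := @is_partial_coordinate R AT AT; have px := @is_partial_coordinate R AT AX.
have py := @is_partial_coordinate R AT AY.
have : is_partial AT cone_arg (fun t x y => - (2 * b * (R0 - b * t))).
  by apply: is_partial_eq; [rewrite /cone_arg; partial_of|move=> t x y /=; ring].
exact: (is_partial_comp is_derive_pos_sq continuous_pos_sq').
Qed.

Lemma is_partialX_cone_weight :
  is_partial AX cone_weight (fun t x y => cone_weight' t x y * (- (2 * (x - x0)))).
Proof.
have pt := @is_partial_coordinate R AX AT; have px := @is_partial_coordinate R AX AX.
have py := @is_partial_coordinate R AX AY.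
have : is_partial AX cone_arg (fun t x y => - (2 * (x - x0))).
  by apply: is_partial_eq; [rewrite /cone_arg; partial_of|move=> t x y /=; ring].
exact: (is_partial_comp is_derive_pos_sq continuous_pos_sq').
Qed.

Lemma is_partialY_cone_weight :
  is_partial AY cone_weight (fun t x y => cone_weight' t x y * (- (2 * (y - y0)))).
Proof.
have pt := @is_partial_coordinate R AY AT; have px := @is_partial_coordinate R AY AX.
have py := @is_partial_coordinate R AY AY.
have : is_partial AY cone_arg (fun t x y => - (2 * (y - y0))).
  by apply: is_partial_eq; [rewrite /cone_arg; partial_of|move=> t x y /=; ring].
exact: (is_partial_comp is_derive_pos_sq continuous_pos_sq').
Qed.

Lemma cone_weight_ge0 t x y : 0 <= cone_weight t x y.
Proof. exact: sqr_ge0. Qed.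

Lemma cone_weight'_ge0 t x y : 0 <= cone_weight' t x y.
Proof. by rewrite mulr_ge0// le_max lexx orbT. Qed.

Lemma cone_weight'_eq0 t x y :
  (R0 - b * t) ^+ 2 <= (x - x0) ^+ 2 + (y - y0) ^+ 2 -> cone_weight' t x y = 0.
Proof. by move=> h; rewrite /cone_weight' max_r ?mulr0// /cone_arg mulNr; lra. Qed.

Lemma cone_weight_eq0 t x y :
  (R0 - b * t) ^+ 2 <= (x - x0) ^+ 2 + (y - y0) ^+ 2 -> cone_weight t x y = 0.
Proof. by move=> h; rewrite /cone_weight /pos_sq max_r ?expr0n// /cone_arg mulNr; lra. Qed.

(** The half-side [|x0| + |y0| + R0] makes the square contain the disc of radius [R0] about
    [(x0, y0)], and this disc contains the support of the cut-off at all the times considered. *)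
Lemma cone_weight_boundary t x y : 0 <= b * t -> b * t <= R0 ->
  `|x| = `|x0| + `|y0| + R0 \/ `|y| = `|x0| + `|y0| + R0 -> cone_weight t x y = 0.
Proof.
move=> bt0 btR xyK; apply: cone_weight_eq0.
have rr : (R0 - b * t) ^+ 2 <= R0 ^+ 2 by rewrite ler_sqr ?nnegrE; lra.
have far (z z0 c : R) : 0 <= c -> `|z| = `|z0| + c + R0 -> R0 ^+ 2 <= (z - z0) ^+ 2.
  move=> c0 h1; rewrite -[(z - z0) ^+ 2]real_normK ?num_real//.
  rewrite ler_sqr ?nnegrE ?normr_ge0//; last lra.
  by apply: le_trans (lerB_dist _ _); lra.
have q1 := sqr_ge0 (x - x0); have q2 := sqr_ge0 (y - y0).
case: xyK => [xK|yK].
- have := @far x x0 `|y0| (normr_ge0 _) xK; lra.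
- have := @far y y0 `|x0| (normr_ge0 _); rewrite yK (addrC `|y0|) => /(_ erefl); lra.
Qed.

End cone_weight.

Section cone.
Context {R : realType}.
Variables (a2 e b : R) (u v : jet (R := R)) (V : R -> R -> R) (L : R).
Hypotheses (ju : is_jet u) (jv : is_jet v).
Hypotheses (a20 : 0 <= a2) (e0 : 0 <= e) (b0 : 0 < b) (bE : b ^+ 2 = a2 + e).
Hypotheses (L0 : 0 <= L) (V0 : forall x y : R, 0 <= V x y).
Hypothesis eq1 : forall t x y : R, 0 < t ->
  jtt u t x y - elastic1 a2 e u v t x y = - (V x y * jt u t x y).
Hypothesis eq2 : forall t x y : R, 0 < t ->
  jtt v t x y - elastic2 a2 e u v t x y = - (V x y * jt v t x y).
Hypothesis init0 : forall x y : R, L ^+ 2 < x ^+ 2 + y ^+ 2 -> density a2 e u v 0 x y = 0.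

Lemma density_ge0 t x y : 0 <= density a2 e u v t x y.
Proof.
by rewrite /density /kinetic /potential; nonneg.
Qed.

(* The maximal speed is b because the acoustic tensor is bounded by a^2 + e = b^2. *)
Lemma flux_le (rho z1 z2 t x y : R) : 0 < rho -> z1 ^+ 2 + z2 ^+ 2 <= rho ^+ 2 ->
  z1 * fluxX a2 e u v (jt u) (jt v) t x y + z2 * fluxY a2 e u v (jt u) (jt v) t x y
    <= b * rho * density a2 e u v t x y.
Proof.
move=> rho0 hz; rewrite /fluxX /fluxY /density /kinetic /potential.
set p := jt u t x y; set q := jt v t x y.
set ux := jx u t x y; set uy := jy u t x y; set vx := jx v t x y; set vy := jy v t x y.
have br0 : 0 < b * rho by exact: mulr_gt0.
(* After multiplication by [2 b rho] the difference is an explicit sum of squares. The square of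
   [z1 q - z2 p] comes from Lagrange's identity and accounts for the divergence part of the flux. *)
rewrite -subr_ge0 -(pmulr_rge0 _ (_ : 0 < 2 * (b * rho))); last by rewrite mulr_gt0.
set s := b * rho.
have -> : 2 * s * (s * (2^-1 * (p ^+ 2 + q ^+ 2 + (a2 * (ux ^+ 2 + uy ^+ 2 + (vx ^+ 2 + vy ^+ 2))
    + e * (ux + vy) ^+ 2))) - (z1 * (a2 * (ux * p + vx * q) + e * ((ux + vy) * p))
    + z2 * (a2 * (uy * p + vy * q) + e * ((ux + vy) * q)))) =
  (a2 + e) * (rho ^+ 2 - (z1 ^+ 2 + z2 ^+ 2)) * (p ^+ 2 + q ^+ 2)
  + a2 * ((s * ux - z1 * p) ^+ 2 + (s * uy - z2 * p) ^+ 2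
          + ((s * vx - z1 * q) ^+ 2 + (s * vy - z2 * q) ^+ 2))
  + e * ((s * (ux + vy) - (z1 * p + z2 * q)) ^+ 2 + (z1 * q - z2 * p) ^+ 2).
  have sE : s ^+ 2 = (a2 + e) * rho ^+ 2 by rewrite /s exprMn bE.
  have -> : (a2 + e) * (rho ^+ 2 - (z1 ^+ 2 + z2 ^+ 2)) = s ^+ 2 - (a2 + e) * (z1 ^+ 2 + z2 ^+ 2).
    by rewrite sE mulrBr.
  by field.
by have : 0 <= rho ^+ 2 - (z1 ^+ 2 + z2 ^+ 2) by [rewrite subr_ge0]; move: (_ - _) => d d0; nonneg.
Qed.

(** The energy localized by the cut-off is nonincreasing: damping has the right sign, and the
    shrinking of the cut-off at speed [b] dominates the flux. It is zero at time 0 because the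
    initial disc misses the data, hence zero at [t1], where the cut-off is still positive at the
    centre. *)
Lemma density_cone (x0 y0 R0 t1 : R) : 0 < R0 -> 0 <= t1 -> b * t1 < R0 ->
  (forall x y : R, (x - x0) ^+ 2 + (y - y0) ^+ 2 < R0 ^+ 2 -> L ^+ 2 < x ^+ 2 + y ^+ 2) ->
  density a2 e u v t1 x0 y0 = 0.
Proof.
move=> R00 t10 bt1 disj.
pose K := `|x0| + `|y0| + R0.
have K0 : 0 <= K by rewrite /K !addr_ge0// ltW.
have Kx : - K < x0 < K by rewrite -ltr_norml /K; have := normr_ge0 y0; lra.
have Ky : - K < y0 < K by rewrite -ltr_norml /K; have := normr_ge0 x0; lra.
have bd t x y : 0 < t < t1 -> `|x| = K \/ `|y| = K -> cone_weight b x0 y0 R0 t x y = 0.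
  move=> /andP[t0 tt1]; apply: cone_weight_boundary; first by rewrite mulr_ge0// ltW.
  by apply: ltW; apply: le_lt_trans bt1; rewrite ler_pM2l// ltW.
move: K K0 Kx Ky bd => K K0 Kx Ky bd.
have pd := is_partialM (is_partial_density a2 e ju jv) (is_partialT_cone_weight b x0 y0 R0).
have pX := is_partialM (is_partial_fluxX a2 e ju jv (jet_tx ju) (jet_tx jv))
  (is_partialX_cone_weight b x0 y0 R0).
have pY := is_partialM (is_partial_fluxY a2 e ju jv (jet_ty ju) (jet_ty jv))
  (is_partialY_cone_weight b x0 y0 R0).
have dJ t := is_derive_int_box t K0 pd.
have cd := is_partial_cont3 pd.
have J_le := is_derive_le0_nincr t10 dJ.
have {}J_le : int_box K (fun t x y => density a2 e u v t x y * cone_weight b x0 y0 R0 t x y) t1 <=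
    int_box K (fun t x y => density a2 e u v t x y * cone_weight b x0 y0 R0 t x y) 0.
  apply: J_le => t t01.
  have [t0 tt1] := andP t01.
  apply: (int_box_divergence_le0 K0 pX pY (is_partial_cont3' pd)).
  - by move=> y; rewrite bd ?mulr0//; left; rewrite ger0_norm.
  - by move=> y; rewrite bd ?mulr0//; left; rewrite normrN ger0_norm.
  - by move=> x; rewrite bd ?mulr0//; right; rewrite ger0_norm.
  - by move=> x; rewrite bd ?mulr0//; right; rewrite normrN ger0_norm.
  move=> x y _ _; rewrite eq1// eq2//.
  have h1 : 0 <= V x y * kinetic u v t x y * cone_weight b x0 y0 R0 t x y.
    by have hV := V0 x y; have hw := cone_weight_ge0 b x0 y0 R0 t x y; rewrite /kinetic; nonneg.
  have h2 : cone_weight' b x0 y0 R0 t x y * ((x - x0) * fluxX a2 e u v (jt u) (jt v) t x y +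
    (y - y0) * fluxY a2 e u v (jt u) (jt v) t x y) <=
    cone_weight' b x0 y0 R0 t x y * (b * (R0 - b * t) * density a2 e u v t x y).
    (* Either the derivative of the cut-off is zero, or [(x - x0, y - y0)] has length below
       [R0 - b t], which is the [rho] of [flux_le]. *)
    have [hz|hz] := leP ((R0 - b * t) ^+ 2) ((x - x0) ^+ 2 + (y - y0) ^+ 2).
      by rewrite cone_weight'_eq0// !mul0r.
    apply: ler_wpM2l; first exact: cone_weight'_ge0.
    apply: flux_le; last exact: ltW.
    by rewrite subr_gt0; apply: lt_trans bt1; rewrite ltr_pM2l.
  move: h1 h2; rewrite /kinetic.
  move: (cone_weight' _ _ _ _ _ _ _) (cone_weight _ _ _ _ _ _ _) (V x y) (density _ _ _ _ _ _ _)
    (fluxX _ _ _ _ _ _ _ _ _) (fluxY _ _ _ _ _ _ _ _ _) (fluxX' _ _ _ _ _ _ _ _ _ _ _)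
    (fluxY' _ _ _ _ _ _ _ _ _ _ _) (jt u t x y) (jt v t x y) => ? ? ? ? ? ? ? ? ? ?.
  lra.
have init : int_box K (fun t x y => density a2 e u v t x y * cone_weight b x0 y0 R0 t x y) 0 = 0.
  apply: int_box_eq0 => x y _ _.
  have [/init0 ->|h] := ltP (L ^+ 2) (x ^+ 2 + y ^+ 2); first by rewrite mul0r.
  rewrite cone_weight_eq0 ?mulr0// subr0.
  by rewrite leNgt; apply/negP => /disj; rewrite ltNge h.
rewrite init in J_le.
have nn x y : - K <= x <= K -> - K <= y <= K ->
    0 <= density a2 e u v t1 x y * cone_weight b x0 y0 R0 t1 x y.
  by move=> _ _; rewrite mulr_ge0 ?density_ge0// cone_weight_ge0.
have /eqP := int_box_le0_eq0 K0 cd nn J_le Kx Ky.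
rewrite mulf_eq0 => /orP[/eqP//|].
(* At the centre the weight is [(R0 - b t1)^4], which is positive. *)
rewrite /cone_weight /pos_sq sqrf_eq0 /cone_arg !subrr !expr0n /= addr0 subr0 max_l ?sqr_ge0//.
by rewrite sqrf_eq0 mulNr subr_eq0 gt_eqF.
Qed.

Lemma finite_speed t x y : 0 <= t -> (b * t + L) ^+ 2 < x ^+ 2 + y ^+ 2 ->
  density a2 e u v t x y = 0.
Proof.
move=> t0 far; set r := Num.sqrt (x ^+ 2 + y ^+ 2).
have bt0 : 0 <= b * t by rewrite mulr_ge0// ltW.
have r2 : r ^+ 2 = x ^+ 2 + y ^+ 2 by rewrite sqr_sqrtr// addr_ge0 ?sqr_ge0.
have r0 : 0 <= r by exact: sqrtr_ge0.
have rL : b * t + L < r.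
  by rewrite -ltr_sqr ?nnegrE ?r2// addr_ge0.
(* The initial radius is the midpoint between [b t], which it must exceed, and [r - L], the distance
   from the point to the disc of the data. The rest is the reverse triangle inequality, through
   Cauchy-Schwarz in [cs]. *)
apply: (@density_cone x y ((b * t + (r - L)) / 2)) => //; [lra|lra|].
move=> x' y' h; rewrite ltNge; apply/negP => h'.
set s := Num.sqrt (x' ^+ 2 + y' ^+ 2).
have s2 : s ^+ 2 = x' ^+ 2 + y' ^+ 2 by rewrite sqr_sqrtr// addr_ge0 ?sqr_ge0.
have s0 : 0 <= s by exact: sqrtr_ge0.
have sL : s <= L by rewrite -ler_sqr ?nnegrE ?s2//.
have cs : x * x' + y * y' <= r * s.
  have [h1|h1] := leP (x * x' + y * y') 0; first by rewrite (le_trans h1)// mulr_ge0.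
  rewrite -ler_sqr ?nnegrE ?mulr_ge0 ?(ltW h1)// exprMn r2 s2.
  have := sqr_ge0 (x * y' - y * x'); lra.
have : ((b * t + (r - L)) / 2) ^+ 2 <= (r - s) ^+ 2.
  rewrite ler_sqr ?nnegrE; lra.
nra.
Qed.

End cone.

(** * A logarithmic Hardy inequality *)

Section composition_at.
Context {R : realType}.
Implicit Types (f : R -> R -> R -> R).

Lemma cont3_comp_at (phi : R -> R) f :
  (forall t x y : R, {for f t x y, continuous phi}) -> cont3 f ->
  cont3 (fun t x y => phi (f t x y)).
Proof.
move=> cphi cf p.
exact: (@continuous_comp _ _ _ (fun p : R * R * R => f p.1.1 p.1.2 p.2) phi p (cf p) (cphi _ _ _)).
Qed.

(** Differentiability of [phi] is only asked at the values of [f], so that the inverse and the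
    logarithm are covered. *)
Lemma is_partial_comp_at i (phi phi' : R -> R) f f' :
  (forall t x y : R, is_derive (f t x y) 1 phi (phi' (f t x y))) ->
  cont3 (fun t x y => phi' (f t x y)) ->
  is_partial i f f' ->
  is_partial i (fun t x y => phi (f t x y)) (fun t x y => phi' (f t x y) * f' t x y).
Proof.
move=> dphi cphi' [cf cf' df]; split.
- apply: cont3_comp_at => // t x y.
  by apply/differentiable_continuous/derivable1_diffP; case: (dphi t x y).
- exact: cont3M.
move=> t x y.
have := dphi t x y; rewrite -{1}(slice_coordinate i f t x y) => dp.
have := @is_derive1_comp _ phi (slice i f t x y) (coordinate i t x y) _ _ dp (df t x y).
by case: i {df dp}.
Qed.

Lemma is_partialV i f f' : (forall t x y, f t x y != 0) -> is_partial i f f' ->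
  is_partial i (fun t x y => (f t x y)^-1) (fun t x y => - (f t x y)^-1 ^+ 2 * f' t x y).
Proof.
move=> f0 pf; have cf := is_partial_cont3 pf.
apply: (@is_partial_comp_at i (fun z => z^-1) (fun z => - z^-1 ^+ 2)) => //.
- move=> t x y.
  have := @is_deriveV _ id (f t x y) 1 1 (f0 t x y) (is_derive_id _ _).
  by rewrite /GRing.scale /= mulr1 exprVn.
- apply: cont3N; apply: cont3X; apply: (@cont3_comp_at (fun z => z^-1)) => // t x y.
  by apply: (@cvgV _ _ _ _ id) => //; exact: cvg_id.
Qed.

Lemma is_partial_ln i f f' : (forall t x y, 0 < f t x y) -> is_partial i f f' ->
  is_partial i (fun t x y => ln (f t x y)) (fun t x y => (f t x y)^-1 * f' t x y).
Proof.
move=> f0 pf; have cf := is_partial_cont3 pf.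
apply: (@is_partial_comp_at i (@ln R) (fun z => z^-1)) => //.
- by move=> t x y; exact: is_derive1_ln.
- have h t x y : f t x y != 0 by rewrite gt_eqF.
  apply: (is_partial_cont3 (is_partialV h pf)).
Qed.

End composition_at.

Section log_hardy.
Context {R : realType}.
Variables (K : R) (f fx fy : R -> R -> R -> R) (t : R).
Hypotheses (K0 : 0 <= K) (pX : is_partial AX f fx) (pY : is_partial AY f fy).
Hypothesis f0 : vanishes K f t.

Definition bracket2 (t x y : R) : R := 1 + (x ^+ 2 + y ^+ 2).

Lemma bracket2_ge1 (s x y : R) : 1 <= bracket2 s x y.
Proof. by rewrite lerDl addr_ge0 ?sqr_ge0. Qed.

Lemma bracket2_gt0 (s x y : R) : 0 < bracket2 s x y.
Proof. exact: lt_le_trans (bracket2_ge1 s x y). Qed.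

Lemma is_partialX_bracket2 : is_partial AX bracket2 (fun _ x _ => 2 * x).
Proof.
have px := @is_partial_coordinate R AX AX; have py := @is_partial_coordinate R AX AY.
by apply: is_partial_eq; [rewrite /bracket2; partial_of|move=> s x y /=; ring].
Qed.

Lemma is_partialY_bracket2 : is_partial AY bracket2 (fun _ _ y => 2 * y).
Proof.
have px := @is_partial_coordinate R AY AX; have py := @is_partial_coordinate R AY AY.
by apply: is_partial_eq; [rewrite /bracket2; partial_of|move=> s x y /=; ring].
Qed.

(** [1 + 2 * K ^+ 2] is the value of [bracket2] at the corners of the box, its maximum there; the
    leading 1 makes [log_gap] at least 1 on the box, where the truncation in [supersol] is then
    inactive. *)
Definition log_weight : R := 1 + ln (1 + 2 * K ^+ 2).

(* M - ln(1 + |x|^2) is superharmonic, but only positive on the box; the cut-off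
   leaves it unchanged where it is at least 1 and keeps it positive everywhere. *)
Definition log_gap (s x y : R) : R := log_weight + - ln (bracket2 s x y).
Definition supersol (s x y : R) : R := log_gap s x y + pos_sq (1 + - log_gap s x y).

Lemma supersol_gt0 s x y : 0 < supersol s x y.
Proof.
rewrite /supersol /pos_sq; move: (log_gap _ _ _) => z.
by have [h|h] := leP (1 + - z) 0; [rewrite expr0n /=; lra|nra].
Qed.

(** Derivative of [supersol] with respect to [ln bracket2]; it equals -1 on the box. *)
Definition supersol' (s x y : R) : R := 2 * Num.max (1 + - log_gap s x y) 0 - 1.

Lemma is_partial_supersol i g' : is_partial i bracket2 g' ->
  is_partial i supersol (fun s x y => supersol' s x y * ((bracket2 s x y)^-1 * g' s x y)).
Proof.
move=> pg.
have pl := is_partial_ln bracket2_gt0 pg.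
have pgap : is_partial i log_gap (fun s x y => - ((bracket2 s x y)^-1 * g' s x y)).
  apply: is_partial_eq (is_partialD (is_partial_cst i log_weight) (is_partialN pl)) _ => s x y.
  by rewrite add0r.
have p1 : is_partial i (fun s x y => 1 + - log_gap s x y)
   (fun s x y => ((bracket2 s x y)^-1 * g' s x y)).
  by apply: is_partial_eq; [partial_of|move=> s x y /=; rewrite add0r opprK].
have p2 := is_partial_comp is_derive_pos_sq continuous_pos_sq' p1.
apply: is_partial_eq; first by rewrite /supersol; partial_of.
by move=> s x y /=; rewrite /supersol'; ring.
Qed.

(** On the box, [(hardyX, hardyY)] is minus the gradient of [ln supersol], the field given by the
    ground-state substitution. *)
Definition hardyX (s x y : R) : R := 2 * x * (bracket2 s x y)^-1 * (supersol s x y)^-1.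
Definition hardyY (s x y : R) : R := 2 * y * (bracket2 s x y)^-1 * (supersol s x y)^-1.
Definition hardyX' (s x y : R) : R :=
  2 * (bracket2 s x y)^-1 * (supersol s x y)^-1
  - (2 * x) ^+ 2 * (bracket2 s x y)^-1 ^+ 2 * (supersol s x y)^-1
  - (2 * x) ^+ 2 * (bracket2 s x y)^-1 ^+ 2 * (supersol s x y)^-1 ^+ 2 * supersol' s x y.
Definition hardyY' (s x y : R) : R :=
  2 * (bracket2 s x y)^-1 * (supersol s x y)^-1
  - (2 * y) ^+ 2 * (bracket2 s x y)^-1 ^+ 2 * (supersol s x y)^-1
  - (2 * y) ^+ 2 * (bracket2 s x y)^-1 ^+ 2 * (supersol s x y)^-1 ^+ 2 * supersol' s x y.

Lemma is_partial_hardyX : is_partial AX hardyX hardyX'.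
Proof.
have px := @is_partial_coordinate R AX AX.
have b0 s x y : bracket2 s x y != 0 by rewrite gt_eqF ?bracket2_gt0.
have s0 s x y : supersol s x y != 0 by rewrite gt_eqF ?supersol_gt0.
have pb := is_partialV b0 is_partialX_bracket2.
have ps := is_partialV s0 (is_partial_supersol is_partialX_bracket2).
apply: is_partial_eq; first by rewrite /hardyX; partial_of.
by move=> s x y /=; rewrite /hardyX'; ring.
Qed.

Lemma is_partial_hardyY : is_partial AY hardyY hardyY'.
Proof.
have px := @is_partial_coordinate R AY AY.
have b0 s x y : bracket2 s x y != 0 by rewrite gt_eqF ?bracket2_gt0.
have s0 s x y : supersol s x y != 0 by rewrite gt_eqF ?supersol_gt0.
have pb := is_partialV b0 is_partialY_bracket2.
have ps := is_partialV s0 (is_partial_supersol is_partialY_bracket2).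
apply: is_partial_eq; first by rewrite /hardyY; partial_of.
by move=> s x y /=; rewrite /hardyY'; ring.
Qed.

Lemma log_gap_box s x y : - K <= x <= K -> - K <= y <= K ->
  1 <= log_gap s x y <= log_weight.
Proof.
move=> xK yK.
have h : 1 + 2 * K ^+ 2 \is Num.pos.
  by rewrite posrE ltr_pwDl// mulr_ge0 ?sqr_ge0.
have b1 : bracket2 s x y \is Num.pos by rewrite posrE bracket2_gt0.
have sq (z : R) : - K <= z <= K -> z ^+ 2 <= K ^+ 2.
  by rewrite -ler_norml => zK; rewrite -[z ^+ 2]real_normK ?num_real// ler_sqr ?nnegrE.
have bK : ln (bracket2 s x y) <= ln (1 + 2 * K ^+ 2).
  rewrite ler_ln// /bracket2; have := sq _ xK; have := sq _ yK; lra.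
have l0 : 0 <= ln (bracket2 s x y) by apply: ln_ge0; exact: bracket2_ge1.
by rewrite /log_gap /log_weight; lra.
Qed.

(** With [H = (hardyX, hardyY)] and [g = log_gap], the divergence of [f^2 H] is [|grad f + f H|^2 -
    |grad f|^2 + f^2 (div H - |H|^2)] and integrates to 0. On the box [div H - |H|^2 = - (Laplacian
    g) / g = 4 / (g bracket2^2)], and [g] is at most [log_weight]. *)
Lemma log_hardy :
  int_box K (fun s x y => 4 * log_weight^-1 * (f s x y ^+ 2 * (bracket2 s x y)^-1 ^+ 2)
    + - (fx s x y ^+ 2 + fy s x y ^+ 2)) t <= 0.
Proof.
have pFX := is_partialM (is_partialX2 pX) is_partial_hardyX.
have pFY := is_partialM (is_partialX2 pY) is_partial_hardyY.
have hK y : K ^+ 2 <= K ^+ 2 + y ^+ 2 by rewrite lerDl sqr_ge0.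
have hK' x : K ^+ 2 <= x ^+ 2 + K ^+ 2 by rewrite lerDr sqr_ge0.
apply: (int_box_divergence_le0 K0 pFX pFY).
- have c1 := is_partial_cont3 pX; have c2 := is_partial_cont3' pX.
  have c3 := is_partial_cont3' pY.
  have b0 s x y : bracket2 s x y != 0 by rewrite gt_eqF ?bracket2_gt0.
  have c4 := is_partial_cont3 (is_partialV b0 is_partialX_bracket2).
  by cont3_of.
- by move=> y; rewrite f0// expr0n mul0r.
- by move=> y; rewrite f0 ?sqrrN// expr0n mul0r.
- by move=> x; rewrite f0// expr0n mul0r.
- by move=> x; rewrite f0 ?sqrrN// expr0n mul0r.
move=> x y xK yK.
have /andP[g1 gM] := log_gap_box t xK yK.
have E : supersol t x y = log_gap t x y.
  by rewrite /supersol /pos_sq max_r ?expr0n ?addr0//; lra.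
have E' : supersol' t x y = -1 by rewrite /supersol' max_r ?mulr0 ?sub0r//; lra.
rewrite /hardyX' /hardyY' /hardyX /hardyY E E'.
move: g1 gM; move: (log_gap t x y) => g g1 gM.
have Mi : log_weight^-1 <= g^-1 by rewrite lef_pV2 ?posrE//; lra.
move: (f t x y) (fx t x y) (fy t x y) => F Fx Fy.
have Bp := bracket2_gt0 t x y.
have BE : (bracket2 t x y)^-1 = (bracket2 t x y)^-1 ^+ 2 * (1 + (x ^+ 2 + y ^+ 2)).
  by rewrite -/(bracket2 t x y); field; rewrite gt_eqF.
set B := (bracket2 t x y)^-1 in BE *.
set I := g^-1 in Mi *.
rewrite -subr_ge0.
have -> : 2 * F * Fx * (2 * x * B * I) +
   F ^+ 2 * (2 * B * I - (2 * x) ^+ 2 * B ^+ 2 * I - (2 * x) ^+ 2 * B ^+ 2 * I ^+ 2 * -1) +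
   (2 * F * Fy * (2 * y * B * I) +
    F ^+ 2 * (2 * B * I - (2 * y) ^+ 2 * B ^+ 2 * I - (2 * y) ^+ 2 * B ^+ 2 * I ^+ 2 * -1)) -
   (4 * log_weight^-1 * (F ^+ 2 * B ^+ 2) + - (Fx ^+ 2 + Fy ^+ 2)) =
   (Fx + F * (2 * x * B * I)) ^+ 2 + (Fy + F * (2 * y * B * I)) ^+ 2
   + 4 * (I - log_weight^-1) * (F ^+ 2 * B ^+ 2)
   + 4 * I * F ^+ 2 * (B - B ^+ 2 * (1 + (x ^+ 2 + y ^+ 2))) by ring.
rewrite -BE subrr mulr0 addr0.
have Mi' : 0 <= I - log_weight^-1 by rewrite subr_ge0.
by move: (I - _) Mi' => d d0; nonneg.
Qed.

End log_hardy.

(** * The weighted energy *)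

(** Differentiability is only asked on the segment, since the powers of [t + T0] are differentiated
    only where the base is positive. *)
Lemma is_derive_le0_nincr_cc (R : realType) (f f' : R -> R) (a b : R) :
  a <= b -> (forall t : R, a <= t <= b -> is_derive t 1 f (f' t)) ->
  (forall t, a < t < b -> f' t <= 0) -> f b <= f a.
Proof.
move=> ab df f'0.
apply: (@ler0_derive1_nincr _ f a b) => //.
- by move=> x; rewrite in_itv /= => /andP[ax xb]; have [] := df x; rewrite ?ltW.
- move=> x; rewrite in_itv /= => xab; have /andP[ax xb] := xab.
  by rewrite derive1E; have [|_ ->] := df x; [rewrite !ltW|exact: f'0].
- by apply: derivable_within_continuous => x; rewrite in_itv /= => /df[].
Qed.

Lemma powR_pred (R : realType) (a r : R) : 0 < a -> a `^ r = a * a `^ (r - 1).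
Proof.
move=> a0; have an : a != 0 by rewrite gt_eqF.
by rewrite powRB ?an ?implybT// powRr1 ?ltW// mulrC divfK.
Qed.

(** Here [p1] and [p3] are [tau^(k - 1)] and [tau^(k - 3)], and [c2] bounds [tau^(k - 2)]. The terms
    in [P], [M] and [X] cancel, which is what fixes the coefficients [k / 2] and [k (k - 1) / 4].
    The remaining [k p1 S] is absorbed by the damping since [k <= beta], and the [Q] term is turned
    into [N] by the lower bound on the potential. *)
Lemma weighted_energy_rate_le (R : realType)
    (k beta tau p1 p3 c2 S P M N Q D X : R) :
  1 < k -> k <= 2 -> k <= beta -> 0 <= p1 -> 0 <= p3 -> tau * p3 <= c2 ->
  beta * S <= tau * D -> beta * Q <= tau * N -> 0 <= S -> 0 <= N ->
  k * p1 * (2^-1 * (S + P)) + tau * p1 * - D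
  + k / 2 * ((k - 1) * (tau * p3) * (M + 2^-1 * N) + p1 * (S - P - X + 2^-1 * (2 * X)))
  - k * (k - 1) / 4 * ((k - 2) * p3 * Q + tau * p3 * (2 * M))
  <= k * (k - 1) / 4 * (1 + (2 - k) / beta) * c2 * N.
Proof.
move=> k1 k2 kb p1_ge0 p3_ge0 pc hS hQ S0 N0.
have b0 : 0 < beta by lra.
have kk4 : 0 <= k * (k - 1) / 4 by rewrite !mulr_ge0//; lra.
have kb2 : 0 <= (2 - k) / beta by rewrite divr_ge0//; lra.
have -> : k * p1 * (2^-1 * (S + P)) + tau * p1 * - D
  + k / 2 * ((k - 1) * (tau * p3) * (M + 2^-1 * N) + p1 * (S - P - X + 2^-1 * (2 * X)))
  - k * (k - 1) / 4 * ((k - 2) * p3 * Q + tau * p3 * (2 * M)) =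
   (p1 * (k * S) - p1 * (tau * D))
   + k * (k - 1) / 4 * (tau * p3 * N + (2 - k) / beta * (p3 * (beta * Q))).
  by field; rewrite gt_eqF.
have h1 := ler_wpM2l p1_ge0 hS.
have h2 := ler_wpM2l p1_ge0 (ler_wpM2r S0 kb).
have hN := ler_wpM2r N0 pc.
have h3 := ler_wpM2l p3_ge0 hQ.
have h4 : (2 - k) / beta * (p3 * (beta * Q)) <= (2 - k) / beta * (c2 * N).
  by rewrite ler_wpM2l//; lra.
have h5 := ler_wpM2l kk4 (lerD hN h4).
lra.
Qed.

(** Here [p] is [tau^(k - 2)]. Half of the multiplier's [N] term dominates [beta Q], so the net
    coefficient of [Q] is proportional to [beta - k + 1]. The nonnegative form, taken at
    [tau / (beta - k + 1)], then cancels both [M] and [Q] at the cost of the fraction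
    [k / (2 (beta - k + 1))] of the kinetic energy. *)
Lemma weighted_energy_coercive (R : realType) (k beta tau p S P M N Q : R) :
  1 < k -> k < 2 * (beta - k + 1) -> 0 <= p -> 0 <= P ->
  0 <= (tau / (beta - k + 1)) ^+ 2 * S + 2 * (tau / (beta - k + 1)) * M + Q ->
  beta * Q <= tau * N ->
  (1 - k / (2 * (beta - k + 1))) * (tau * (tau * p) * (2^-1 * (S + P))) <=
  tau * (tau * p) * (2^-1 * (S + P)) + k / 2 * (tau * p * (M + 2^-1 * N))
  - k * (k - 1) / 4 * (p * Q).
Proof.
move=> k1 kk p0 P0 hM hQ.
have mu0 : 0 < beta - k + 1 by lra.
have bE : beta = (beta - k + 1) + k - 1 by ring.
move: (beta - k + 1) kk mu0 bE hM => m kk mu0 bE hM.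
have k4 : 0 <= k / 4 * (p * m) by rewrite !mulr_ge0//; lra.
have h1 := mulr_ge0 k4 hM.
have k4' : 0 <= k / 4 * p by rewrite !mulr_ge0//; lra.
have h2 := ler_wpM2l k4' hQ.
have km : 0 <= k / (2 * m) by rewrite divr_ge0//; lra.
have h3 : 0 <= k / (2 * m) * (p * tau ^+ 2 * P) by move: (k / _) km => d d0; nonneg.
rewrite bE in h2.
have E1 : k / 4 * (p * m) * ((tau / m) ^+ 2 * S + 2 * (tau / m) * M + Q) =
  k / (2 * m) / 2 * (p * tau ^+ 2) * S + k / 2 * (p * tau * M) + k / 4 * (p * m * Q).
  by field; rewrite gt_eqF.
rewrite E1 in h1.
rewrite -subr_ge0.
lra.
Qed.

Section weighted_energy.
Context {R : realType}.
(** Intended meaning, with integrals over the box: [E] is the energy, [S] and [P] the kinetic and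
    potential integrals (without the factor 1/2), [M] that of [u . u_t], [Q] that of [|u|^2]; [D],
    [X], [N] are [S], [M], [Q] with the factor [V] inserted. [Z] is the energy of the time primitive
    minus the work of the source. *)
Variables (beta k T0 T : R) (E S P M N Q D X Z E' M' N' Q' Z' : R -> R).
Hypotheses (k1 : 1 < k) (k2 : k <= 2) (kb : k <= beta) (kk : k < 2 * (beta - k + 1)).
Hypotheses (T00 : 0 < T0) (T_ge0 : 0 <= T).
Hypotheses (dE : forall t : R, is_derive t 1 E (E' t))
  (dM : forall t : R, is_derive t 1 M (M' t)) (dN : forall t : R, is_derive t 1 N (N' t))
  (dQ : forall t : R, is_derive t 1 Q (Q' t)) (dZ : forall t : R, is_derive t 1 Z (Z' t)).
Hypothesis E'E : forall t, 0 < t < T -> E' t = - D t.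
Hypothesis M'E : forall t, 0 < t < T -> M' t = S t - P t - X t.
Hypothesis N'E : forall t, 0 < t < T -> N' t = 2 * X t.
Hypothesis Q'E : forall t, 0 < t < T -> Q' t = 2 * M t.
Hypothesis Z'E : forall t, 0 < t < T -> Z' t = - N t.
Hypothesis ESP : forall t, E t = 2^-1 * (S t + P t).
Hypotheses (S0 : forall t, 0 <= S t) (P0 : forall t, 0 <= P t)
  (N0 : forall t, 0 <= N t).
Hypothesis SD : forall t, 0 <= t <= T -> beta * S t <= (t + T0) * D t.
Hypothesis QN : forall t, 0 <= t <= T -> beta * Q t <= (t + T0) * N t.
Hypothesis SMQ : forall t l, 0 <= l ^+ 2 * S t + 2 * l * M t + Q t.

Definition weighted_energy (t : R) : R :=
  (t + T0) `^ k * E t + k / 2 * ((t + T0) `^ (k - 1) * (M t + 2^-1 * N t))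
  - k * (k - 1) / 4 * ((t + T0) `^ (k - 2) * Q t).

Definition weighted_energy' (t : R) : R :=
  (k * (t + T0) `^ (k - 1) * E t + (t + T0) `^ k * E' t)
  + k / 2 * ((k - 1) * (t + T0) `^ (k - 2) * (M t + 2^-1 * N t)
             + (t + T0) `^ (k - 1) * (M' t + 2^-1 * N' t))
  - k * (k - 1) / 4 * ((k - 2) * (t + T0) `^ (k - 3) * Q t + (t + T0) `^ (k - 2) * Q' t).

Lemma is_derive_weighted_energy (t : R) : 0 <= t ->
  is_derive t 1 weighted_energy (weighted_energy' t).
Proof.
move=> t0; have tT : 0 < t + T0 by rewrite ltr_wpDl.
have ds : is_derive t 1 (fun t : R => t + T0) 1.
  by have := is_deriveD (is_derive_id t (1 : R)) (is_derive_cst T0 t (1 : R)); rewrite addr0.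
have dp r : is_derive t 1 (fun t => (t + T0) `^ r) (r * (t + T0) `^ (r - 1)).
  have := @is_derive1_comp _ (@powR R ^~ r) (fun t => t + T0) t _ _ (is_derive1_powR r tT) ds.
  by rewrite mulr1.
have dm (f g : R -> R) (f' g' : R) : is_derive t 1 f f' -> is_derive t 1 g g' ->
    is_derive t 1 (fun t => f t * g t) (f' * g t + f t * g').
  by move=> df dg; have := is_deriveM df dg; rewrite /GRing.scale /= addrC (mulrC (g t)).
have dZ' (c : R) (f : R -> R) (f' : R) : is_derive t 1 f f' ->
    is_derive t 1 (fun t => c * f t) (c * f').
  by move=> df; have := is_deriveZ c df.
have d1 := dm _ _ _ _ (dp k) (dE t).
have dMN := is_deriveD (dM t) (dZ' 2^-1 _ _ (dN t)).
have d2 := dZ' (k / 2) _ _ (dm _ _ _ _ (dp (k - 1)) dMN).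
have d3 := dZ' (k * (k - 1) / 4) _ _ (dm _ _ _ _ (dp (k - 2)) (dQ t)).
have := is_deriveB (is_deriveD d1 d2) d3.
have e2 : k - 2 = k - 1 - 1 by ring.
have e3 : k - 3 = k - 1 - 1 - 1 by ring.
rewrite /weighted_energy' e2 e3 => H; rewrite /weighted_energy e2.
exact: H.
Qed.

Definition source_cst : R := k * (k - 1) / 4 * (1 + (2 - k) / beta) * T0 `^ (k - 2).

Lemma weighted_energy'_le (t : R) : 0 < t < T -> weighted_energy' t <= source_cst * N t.
Proof.
move=> tT; have /andP[t0 t1] := tT.
have tT' : 0 <= t <= T by rewrite !ltW.
have tau : 0 < t + T0 by apply: addr_gt0.
have sp r := powR_pred r tau.
rewrite /weighted_energy' E'E// M'E// N'E// Q'E// ESP.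
have e1 : (t + T0) `^ k = (t + T0) * (t + T0) `^ (k - 1) := sp k.
have e2 : (t + T0) `^ (k - 2) = (t + T0) * (t + T0) `^ (k - 3).
  by rewrite sp; congr (_ * _ `^ _); ring.
(* This is where [k <= 2] is needed: [tau^(k - 2)] is then largest at time 0. *)
have p2T : (t + T0) * (t + T0) `^ (k - 3) <= T0 `^ (k - 2).
  rewrite -e2 (_ : k - 2 = - (2 - k)); last by ring.
  rewrite !powRN lef_pV2 ?posrE ?powR_gt0//.
  apply: ge0_ler_powR; rewrite ?nnegrE ?subr_ge0//; [exact: ltW|exact: ltW|].
  by rewrite lerDr ltW.
rewrite e1 e2; apply: weighted_energy_rate_le => //; try exact: powR_ge0.
- exact: SD.
- exact: QN.
Qed.

Lemma weighted_energy_ge :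
  (1 - k / (2 * (beta - k + 1))) * ((T + T0) `^ k * E T) <= weighted_energy T.
Proof.
have tau : 0 < T + T0 by apply: ltr_wpDl.
have sp r := powR_pred r tau.
rewrite /weighted_energy ESP.
have e1 : (T + T0) `^ k = (T + T0) * (T + T0) `^ (k - 1) := sp k.
have e2 : (T + T0) `^ (k - 1) = (T + T0) * (T + T0) `^ (k - 2).
  by rewrite sp; congr (_ * _ `^ _); ring.
rewrite e1 e2; apply: weighted_energy_coercive => //; first exact: powR_ge0.
by apply: QN; rewrite T_ge0 lexx.
Qed.

(** As [Z' = - N], adding [source_cst * Z] to the weighted energy compensates its possible growth,
    and the sum is nonincreasing. *)
Lemma weighted_energy_bound :
  (1 - k / (2 * (beta - k + 1))) * ((T + T0) `^ k * E T) <=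
  weighted_energy 0 + source_cst * (Z 0 - Z T).
Proof.
apply: (le_trans weighted_energy_ge).
have d t : 0 <= t <= T ->
   is_derive t 1 (fun t => weighted_energy t + source_cst * Z t)
     (weighted_energy' t + source_cst * Z' t).
  by move=> /andP[t0 _]; apply: is_deriveD (is_derive_weighted_energy t0) (is_deriveZ source_cst (dZ t)).
have H := is_derive_le0_nincr_cc T_ge0 d.
have : weighted_energy T + source_cst * Z T <= weighted_energy 0 + source_cst * Z 0.
  by apply: H => t tT; rewrite Z'E// mulrN subr_le0 weighted_energy'_le.
by rewrite mulrBr addrA lerBrDr.
Qed.

End weighted_energy.

(** * The equation integrated in time *)

Lemma is_derive_eq0_cst (R : realType) (f f' : R -> R) (a b : R) :
  a <= b -> (forall t : R, is_derive t 1 f (f' t)) ->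
  (forall t, a < t < b -> f' t = 0) -> f b = f a.
Proof.
move=> ab df f'0; apply/eqP; rewrite eq_le (is_derive_le0_nincr ab df); last first.
  by move=> t /f'0 ->.
rewrite -lerN2 (is_derive_le0_nincr (f := fun t => - f t) (f' := fun t => - f' t) ab)//.
by move=> t /f'0 ->; rewrite oppr0.
Qed.

(** Young's inequality between [F * bracket2] and [f / bracket2], scaled so that the resulting [f^2]
    term is exactly [c] times the left side of the Hardy inequality; pointwise, the difference is a
    perfect square. *)
Lemma int_box_source (R : realType) K c (f fx fy F : R -> R -> R -> R) (t : R) :
  0 <= K -> 0 < c -> is_partial AX f fx -> is_partial AY f fy -> cont3 F -> vanishes K f t ->
  int_box K (fun s x y => F s x y * f s x y + - (c * (fx s x y ^+ 2 + fy s x y ^+ 2))) t <=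
  log_weight K * (16 * c)^-1 * int_box K (fun s x y => (F s x y * bracket2 s x y) ^+ 2) t.
Proof.
move=> K0 c0 pX pY cF f0.
have c1 := is_partial_cont3 pX; have c2 := is_partial_cont3' pX; have c3 := is_partial_cont3' pY.
have cb := is_partial_cont3 (@is_partialX_bracket2 R).
have b0 (s x y : R) : bracket2 s x y != 0 by rewrite gt_eqF ?bracket2_gt0.
have cbV := is_partial_cont3 (is_partialV b0 (@is_partialX_bracket2 R)).
have M0 : 0 < log_weight K.
  by rewrite /log_weight ltr_pwDl// ln_ge0// lerDl mulr_ge0// sqr_ge0.
have H := log_hardy K0 pX pY f0.
have cG : cont3 (fun s x y => 4 * (log_weight K)^-1 * (f s x y ^+ 2 * (bracket2 s x y)^-1 ^+ 2)
    + - (fx s x y ^+ 2 + fy s x y ^+ 2)) by cont3_of.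
have cS : cont3 (fun s x y => (F s x y * bracket2 s x y) ^+ 2) by cont3_of.
rewrite -int_boxZ//.
have H' : c * int_box K (fun s x y => 4 * (log_weight K)^-1 *
    (f s x y ^+ 2 * (bracket2 s x y)^-1 ^+ 2) + - (fx s x y ^+ 2 + fy s x y ^+ 2)) t <= 0.
  by rewrite mulr_ge0_le0// ltW.
rewrite -int_boxZ// in H'.
rewrite -[leRHS]addr0; apply: (le_trans _ (lerD (lexx _) H')).
rewrite -int_boxD//; [|by cont3_of|by cont3_of].
apply: le_int_box => //; [by cont3_of|by cont3_of|].
move=> x y _ _.
have bg := bracket2_gt0 t x y.
move: (log_weight K) (bracket2 t x y) (F t x y) (f t x y) (fx t x y) (fy t x y) M0 bg
  => M B G g gx gy M0 B0.
rewrite -subr_ge0.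
have -> : M * (16 * c)^-1 * (G * B) ^+ 2 +
   c * (4 * M^-1 * (g ^+ 2 * B^-1 ^+ 2) + - (gx ^+ 2 + gy ^+ 2)) -
   (G * g + - (c * (gx ^+ 2 + gy ^+ 2))) =
   M * (16 * c)^-1 * (G * B - 8 * c * g * M^-1 * B^-1) ^+ 2.
  by field; rewrite !gt_eqF.
by rewrite mulr_ge0 ?sqr_ge0// divr_ge0 ?mulr_ge0// ltW.
Qed.

Section damped_elastic.
Context {R : realType}.
Implicit Types (W f : R -> R -> R -> R) (V : R -> R -> R).

(** The curried form of the problem: [a2], [e], [kappa] stand for [a^2], [b^2 - a^2], [V0], and
    [W1], [W2] are the components of a smooth extension of the solution to all times. The equations
    are still required for positive times only. *)
Record damped_elastic (a2 e b L kappa : R) V W1 W2 : Prop := DampedElastic {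
  de_smooth1 : smooth3 3 W1;
  de_smooth2 : smooth3 3 W2;
  de_contV : cont3 (fun _ x y => V x y);
  de_a2 : 0 < a2;
  de_e : 0 <= e;
  de_b : 0 < b;
  de_bE : b ^+ 2 = a2 + e;
  de_L : 0 < L;
  de_kappa : 0 < kappa;
  de_V : forall x y : R, kappa / (1 + Num.sqrt (x ^+ 2 + y ^+ 2)) <= V x y;
  de_eq1 : forall t x y : R, 0 < t -> partial AT (partial AT W1) t x y
    - elastic1 a2 e (jet_of W1) (jet_of W2) t x y = - (V x y * partial AT W1 t x y);
  de_eq2 : forall t x y : R, 0 < t -> partial AT (partial AT W2) t x y
    - elastic2 a2 e (jet_of W1) (jet_of W2) t x y = - (V x y * partial AT W2 t x y);
  de_init : forall x y : R, L ^+ 2 < x ^+ 2 + y ^+ 2 ->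
    [/\ W1 0 x y = 0, W2 0 x y = 0, partial AT W1 0 x y = 0 & partial AT W2 0 x y = 0] }.

Lemma damped_ge0 a2 e b L kappa V W1 W2 : damped_elastic a2 e b L kappa V W1 W2 ->
  forall x y, 0 <= V x y.
Proof.
move=> S x y; apply: (le_trans _ (de_V S x y)).
by rewrite divr_ge0 ?(ltW (de_kappa S))// addr_ge0// sqrtr_ge0.
Qed.

(** The exterior of the disc is open, so [f 0] vanishes near the point along each space axis.
    Nothing of the kind holds along the time axis. *)
Lemma partial_eq0_outside i f L : i <> AT ->
  (forall x y : R, L ^+ 2 < x ^+ 2 + y ^+ 2 -> f 0 x y = 0) ->
  forall x y : R, L ^+ 2 < x ^+ 2 + y ^+ 2 -> partial i f 0 x y = 0.
Proof.
move=> iT f0 x y xy.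
have op (z : R) : \forall s \near z, L ^+ 2 - (x ^+ 2 + y ^+ 2 - z ^+ 2) < s ^+ 2.
  have := @exprn_continuous R 2 z; move=> /cvgr_gt; apply.
  by rewrite opprB addrA ltrBlDr addrC ltrD2l.
case: i iT => // _; rewrite /partial /=.
- rewrite (@near_eq_derive _ _ _ _ (fun=> 0)) ?derive_cst//.
  by near=> s; apply: f0; have : L ^+ 2 - (x ^+ 2 + y ^+ 2 - x ^+ 2) < s ^+ 2 by [near: s; exact: op]; lra.
- rewrite (@near_eq_derive _ _ _ _ (fun=> 0)) ?derive_cst//.
  by near=> s; apply: f0; have : L ^+ 2 - (x ^+ 2 + y ^+ 2 - y ^+ 2) < s ^+ 2 by [near: s; exact: op]; lra.
Unshelve. all: by end_near. Qed.

Lemma damped_density0 a2 e b L kappa V W1 W2 : damped_elastic a2 e b L kappa V W1 W2 ->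
  forall t x y, 0 <= t -> (b * t + L) ^+ 2 < x ^+ 2 + y ^+ 2 ->
  density a2 e (jet_of W1) (jet_of W2) t x y = 0.
Proof.
move=> S t x y t0 far.
have j1 := is_jet_of (de_smooth1 S); have j2 := is_jet_of (de_smooth2 S).
apply: (@finite_speed _ a2 e b _ _ V L j1 j2 (ltW (de_a2 S)) (de_e S) (de_b S) (de_bE S)
  (ltW (de_L S)) (damped_ge0 S) (de_eq1 S) (de_eq2 S)) => // {t0 far} x' y' xy.
have [? ? t1 t2] := de_init S xy.
have x1 : partial AX W1 0 x' y' = 0.
  by apply: (@partial_eq0_outside AX _ L) => // ? ? /(de_init S)[].
have x2 : partial AX W2 0 x' y' = 0.
  by apply: (@partial_eq0_outside AX _ L) => // ? ? /(de_init S)[].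
have y1 : partial AY W1 0 x' y' = 0.
  by apply: (@partial_eq0_outside AY _ L) => // ? ? /(de_init S)[].
have y2 : partial AY W2 0 x' y' = 0.
  by apply: (@partial_eq0_outside AY _ L) => // ? ? /(de_init S)[].
rewrite /density /kinetic /potential /= t1 t2 x1 x2 y1 y2.
by rewrite !expr2 !(mulr0, addr0).
Qed.

Lemma density_eq0 a2 e (u v : jet (R := R)) t x y : 0 < a2 -> 0 <= e ->
  density a2 e u v t x y = 0 -> jt u t x y = 0 /\ jt v t x y = 0.
Proof.
move=> a20 e0; rewrite /density /kinetic => /eqP; rewrite mulf_eq0 invr_eq0 pnatr_eq0 /=.
have P0 : 0 <= potential a2 e u v t x y by have := ltW a20; rewrite /potential => ?; nonneg.
have k0 : 0 <= jt u t x y ^+ 2 + jt v t x y ^+ 2 by nonneg.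
rewrite (paddr_eq0 k0 P0) => /andP[+ _].
by rewrite paddr_eq0 ?sqr_ge0// !sqrf_eq0 => /andP[/eqP -> /eqP ->].
Qed.

(** A zero energy density only gives [u_t = 0]. A point outside the cone at time [t] was outside it
    at all earlier times, so [u] keeps its initial value there, which is 0. *)
Lemma damped_supp a2 e b L kappa V W1 W2 : damped_elastic a2 e b L kappa V W1 W2 ->
  forall t x y, 0 <= t -> (b * t + L) ^+ 2 < x ^+ 2 + y ^+ 2 ->
  [/\ W1 t x y = 0, W2 t x y = 0, partial AT W1 t x y = 0 & partial AT W2 t x y = 0].
Proof.
move=> S t x y t0 far.
have far' s : 0 <= s <= t -> (b * s + L) ^+ 2 < x ^+ 2 + y ^+ 2.
  move=> /andP[s0 st]; apply: le_lt_trans far.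
  have b0 := ltW (de_b S); have L0 := ltW (de_L S).
  by rewrite ler_sqr ?nnegrE ?addr_ge0 ?mulr_ge0// lerD2r ler_wpM2l.
have dt0 s : 0 <= s <= t -> partial AT W1 s x y = 0 /\ partial AT W2 s x y = 0.
  move=> st; have /andP[s0 _] := st.
  exact: (density_eq0 (de_a2 S) (de_e S) (damped_density0 S s0 (far' s st))).
have far0 : L ^+ 2 < x ^+ 2 + y ^+ 2 by have := far' 0; rewrite mulr0 add0r lexx t0; apply.
have [w1 w2 _ _] := de_init S far0.
have [p1 _] := de_smooth1 S AT; have [p2 _] := de_smooth2 S AT.
have [tt1 tt2] : partial AT W1 t x y = 0 /\ partial AT W2 t x y = 0 by apply: dt0; rewrite t0 lexx.
split => //.
- rewrite -w1; apply: (is_derive_eq0_cst t0 (fun s => is_partial_val s x y p1)) => s /andP[s0 st].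
  by have [] := dt0 s; rewrite ?ltW.
- rewrite -w2; apply: (is_derive_eq0_cst t0 (fun s => is_partial_val s x y p2)) => s /andP[s0 st].
  by have [] := dt0 s; rewrite ?ltW.
Qed.

Lemma primitive_supp a2 e b L kappa V W1 W2 : damped_elastic a2 e b L kappa V W1 W2 ->
  forall t x y, 0 <= t -> (b * t + L) ^+ 2 < x ^+ 2 + y ^+ 2 ->
  primitive W1 t x y = 0 /\ primitive W2 t x y = 0.
Proof.
move=> S t x y t0 far; rewrite /primitive.
have far' s : 0 <= s <= 1 -> (b * (t * s) + L) ^+ 2 < x ^+ 2 + y ^+ 2.
  move=> /andP[s0 st]; apply: le_lt_trans far.
  have b0 := ltW (de_b S); have L0 := ltW (de_L S).
  rewrite ler_sqr ?nnegrE ?addr_ge0 ?mulr_ge0// lerD2r ler_wpM2l//.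
  by rewrite ler_piMr.
by rewrite !int_cc_eq0 ?mulr0// => s st; have /andP[s0 _] := st;
  have [] := damped_supp S (mulr_ge0 t0 s0) (far' s st).
Qed.

(** The source of the equation integrated in time. Its time argument is a dummy, kept so that it can
    be used under [int_box] and [is_partial]. *)
Definition source V W (_ x y : R) : R := partial AT W 0 x y + V x y * W 0 x y.

Lemma cont3_freeze f : cont3 f -> cont3 (fun _ x y => f 0 x y).
Proof.
move=> cf; apply: (cont3_subst cf).
- exact: cont3_cst.
- exact: (@cont3_coordinate _ AX).
- exact: (@cont3_coordinate _ AY).
Qed.

Lemma cont3_source a2 e b L kappa V W1 W2 : damped_elastic a2 e b L kappa V W1 W2 ->
  cont3 (source V W1) /\ cont3 (source V W2).
Proof.
move=> S; have cV := de_contV S.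
have c1 := cont3_freeze (is_partial_cont3 (de_smooth1 S AT).1).
have c2 := cont3_freeze (is_partial_cont3' (de_smooth1 S AT).1).
have c3 := cont3_freeze (is_partial_cont3 (de_smooth2 S AT).1).
have c4 := cont3_freeze (is_partial_cont3' (de_smooth2 S AT).1).
by split; rewrite /source; cont3_of.
Qed.

Lemma is_partial_cstT V : cont3 (fun _ x y => V x y) ->
  is_partial AT (fun _ x y => V x y) (fun _ _ _ => 0).
Proof. by move=> cV; split => //; [exact: cont3_cst|move=> t x y; exact: is_derive_cst]. Qed.

(** The [p]'s are antiderivatives in time of the [q]'s that vanish at time 0. By the equation, the
    left side plus [V w] has zero time derivative, so it keeps its initial value. *)
Lemma integrated_equation (a2 e : R) V
    (w w0 w00 p1 p2 p3 p4 q1 q2 q3 q4 : R -> R -> R -> R) :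
  is_partial AT (fun _ x y => V x y) (fun _ _ _ => 0) ->
  is_partial AT w w0 -> is_partial AT w0 w00 ->
  is_partial AT p1 q1 -> is_partial AT p2 q2 -> is_partial AT p3 q3 -> is_partial AT p4 q4 ->
  (forall x y, [/\ p1 0 x y = 0, p2 0 x y = 0, p3 0 x y = 0 & p4 0 x y = 0]) ->
  (forall t x y, 0 < t -> w00 t x y - (a2 * (q1 t x y + q2 t x y) + e * (q3 t x y + q4 t x y)) =
    - (V x y * w0 t x y)) ->
  forall t x y, 0 <= t -> w0 t x y - (a2 * (p1 t x y + p2 t x y) + e * (p3 t x y + p4 t x y)) =
    w0 0 x y + V x y * w 0 x y - V x y * w t x y.
Proof.
move=> pV pw pw0 P1 P2 P3 P4 P0 eq t x y t0.
have p : is_partial AT (fun t x y => w0 t x y +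
      - (a2 * (p1 t x y + p2 t x y) + e * (p3 t x y + p4 t x y)) + V x y * w t x y)
    (fun t x y => w00 t x y - (a2 * (q1 t x y + q2 t x y) + e * (q3 t x y + q4 t x y))
      + V x y * w0 t x y).
  apply: is_partial_eq; first by partial_of.
  by move=> {t0} {}t {}x {}y /=; ring.
have := is_derive_eq0_cst t0 (fun s => is_partial_val s x y p).
have [-> -> -> ->] := P0 x y.
rewrite /= !(addr0, mulr0) subr0 => <-; first by rewrite addrK.
by move=> s /andP[s0 _]; rewrite eq// addNr.
Qed.

Lemma is_partial_primitive_partial g h W : smooth3 3 W ->
  is_partial AT (primitive (partial g (partial h W))) (partial g (partial h W)).
Proof.
move=> sf; have [_ sh] := sf h; have [_ sg] := sh g; have [pg _] := sg AT.
exact: is_partial_primitive pg.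
Qed.

(* The equation integrated in time: its time derivative is the original one. *)
Lemma primitive_equation a2 e b L kappa V W1 W2 : damped_elastic a2 e b L kappa V W1 W2 ->
  forall t x y, 0 <= t ->
  partial AT W1 t x y - elastic1 a2 e (jet_primitive W1) (jet_primitive W2) t x y
    = source V W1 t x y - V x y * W1 t x y /\
  partial AT W2 t x y - elastic2 a2 e (jet_primitive W1) (jet_primitive W2) t x y
    = source V W2 t x y - V x y * W2 t x y.
Proof.
move=> S t x y t0.
have [p1t s1t] := de_smooth1 S AT; have [p2t s2t] := de_smooth2 S AT.
have [p1tt _] := s1t AT; have [p2tt _] := s2t AT.
have pV := is_partial_cstT (de_contV S).
have prim1 g h := is_partial_primitive_partial g h (de_smooth1 S).
have prim2 g h := is_partial_primitive_partial g h (de_smooth2 S).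
split.
- apply: (integrated_equation pV p1t p1tt (prim1 AX AX) (prim1 AY AY) (prim1 AX AX) (prim2 AX AY)) => //.
  + by move=> x' y'; split; exact: primitive0.
  + exact: (de_eq1 S).
- apply: (integrated_equation pV p2t p2tt (prim2 AX AX) (prim2 AY AY) (prim1 AY AX) (prim2 AY AY)) => //.
  + by move=> x' y'; split; exact: primitive0.
  + exact: (de_eq2 S).
Qed.

End damped_elastic.

(** * Energy estimates on a box *)

(** The kinetic and divergence parts of the energy are dropped: what is left decouples into the two
    components, and [int_box_source] applies to each with [c = a2 / 2]. *)
Lemma work_density_le (R : realType) (a2 e f1 f2 x1 x2 y1 y2 t1 t2 F1 F2 : R) : 0 <= e ->
  F1 * f1 + F2 * f2 + -1 * (2^-1 * (t1 ^+ 2 + t2 ^+ 2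
    + (a2 * (x1 ^+ 2 + y1 ^+ 2 + (x2 ^+ 2 + y2 ^+ 2)) + e * (x1 + y2) ^+ 2))) <=
  F1 * f1 + - (a2 / 2 * (x1 ^+ 2 + y1 ^+ 2)) + (F2 * f2 + - (a2 / 2 * (x2 ^+ 2 + y2 ^+ 2))).
Proof.
move=> e0; rewrite -subr_ge0.
rewrite [X in 0 <= X](_ : _ = 2^-1 * (t1 ^+ 2 + t2 ^+ 2) + 2^-1 * (e * (x1 + y2) ^+ 2)); last by field.
by nonneg.
Qed.

Section decay.
Context {R : realType}.
Implicit Types (W f : R -> R -> R -> R) (V : R -> R -> R).

Definition mass W1 W2 (t x y : R) : R := W1 t x y ^+ 2 + W2 t x y ^+ 2.
Definition weigh V f (t x y : R) : R := V x y * f t x y.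
Definition work F1 F2 W1 W2 (t x y : R) : R := F1 t x y * W1 t x y + F2 t x y * W2 t x y.

(** The derivative is left as ['D_1] because it exists at every time, while its value is identified
    through the equation only between 0 and [T]. *)
Lemma is_derive_int_boxD (f f' : R -> R -> R -> R) K (t : R) : 0 <= K -> is_partial AT f f' ->
  is_derive t 1 (int_box K f) ('D_1 (int_box K f) t).
Proof. by move=> K0 pf; apply: derivableP; case: (is_derive_int_box t K0 pf). Qed.

(** The extra 1 in the radius turns vanishing strictly outside the cone into vanishing on the
    boundary of the box as well. *)
Lemma vanishes_of_supp (b L T t : R) f : 0 < b -> 0 < L -> 0 <= t <= T ->
  (forall x y : R, (b * t + L) ^+ 2 < x ^+ 2 + y ^+ 2 -> f t x y = 0) ->
  vanishes (b * T + L + 1) f t.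
Proof.
move=> b0 L0 /andP[t0 tT] f0 x y h; apply: f0; apply: lt_le_trans h.
have h1 : b * t <= b * T by rewrite ler_pM2l.
have h2 : 0 <= b * t by rewrite mulr_ge0// ltW.
by rewrite ltr_sqr ?nnegrE; lra.
Qed.

Variables (a2 e b L kappa : R) (V : R -> R -> R) (W1 W2 : R -> R -> R -> R).
Hypothesis S : damped_elastic a2 e b L kappa V W1 W2.

Let u := jet_of W1.
Let v := jet_of W2.
Let pu := jet_primitive W1.
Let pv := jet_primitive W2.
Let ju : is_jet u := is_jet_of (de_smooth1 S).
Let jv : is_jet v := is_jet_of (de_smooth2 S).
Let jpu : is_jet pu := is_jet_primitive (de_smooth1 S).
Let jpv : is_jet pv := is_jet_primitive (de_smooth2 S).
Let p1 : is_partial AT W1 (partial AT W1) := jet_t ju.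
Let p2 : is_partial AT W2 (partial AT W2) := jet_t jv.
Let c1 : cont3 W1 := is_partial_cont3 p1.
Let c2 : cont3 W2 := is_partial_cont3 p2.
Let cV := de_contV S.
Let pV := is_partial_cstT cV.

Lemma is_partial_mass : is_partial AT (mass W1 W2) (fun t x y => 2 * virial u v t x y).
Proof.
apply: is_partial_eq; first by rewrite /mass; partial_of.
by move=> t x y /=; rewrite /virial /=; ring.
Qed.

Lemma is_partial_weigh f f' : is_partial AT f f' -> is_partial AT (weigh V f) (weigh V f').
Proof.
move=> pf; apply: is_partial_eq; first by rewrite /weigh; partial_of.
by move=> t x y /=; rewrite /weigh; ring.
Qed.

Lemma cont3_weigh f : cont3 f -> cont3 (weigh V f).
Proof. by move=> cf; rewrite /weigh; cont3_of. Qed.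

Lemma cont3_virial : cont3 (virial u v).
Proof. exact: is_partial_cont3 (is_partial_virial a2 e ju jv). Qed.

Lemma cont3_mass : cont3 (mass W1 W2).
Proof. exact: is_partial_cont3 is_partial_mass. Qed.

Lemma cont3_density : cont3 (density a2 e u v).
Proof. exact: is_partial_cont3 (is_partial_density a2 e ju jv). Qed.

Lemma cont3_densityp : cont3 (density a2 e pu pv).
Proof. exact: is_partial_cont3 (is_partial_density a2 e jpu jpv). Qed.

Lemma damped_V_lower t x y : 0 <= t -> x ^+ 2 + y ^+ 2 <= (b * t + L) ^+ 2 ->
  kappa / b <= (t + (1 + L) / b) * V x y.
Proof.
move=> t0 xy; have b0 := de_b S; have L0 := de_L S.
have hV := de_V S x y.
have bt : 0 <= b * t by rewrite mulr_ge0// ltW.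
have bL : 0 <= b * t + L by rewrite addr_ge0// ltW.
have s : Num.sqrt (x ^+ 2 + y ^+ 2) <= b * t + L.
  by rewrite -ler_sqr ?nnegrE ?sqrtr_ge0// sqr_sqrtr// addr_ge0 ?sqr_ge0.
have p1' : 0 < 1 + (b * t + L) by rewrite ltr_pwDl.
have p2' : 0 < 1 + Num.sqrt (x ^+ 2 + y ^+ 2) by rewrite ltr_pwDl// sqrtr_ge0.
(* The time shift [(1 + L) / b] is chosen so that [1 + (b t + L) = b (t + (1 + L) / b)]. *)
rewrite (_ : kappa / b = (t + (1 + L) / b) * (kappa / (1 + (b * t + L)))); last first.
  by field; rewrite !gt_eqF.
apply: ler_wpM2l; first by rewrite addr_ge0// divr_ge0 ?addr_ge0// ltW.
apply: le_trans hV; rewrite ler_wpM2l ?(ltW (de_kappa S))//.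
by rewrite lef_pV2 ?posrE// lerD2l.
Qed.

Section box.
Variable T : R.
Hypothesis T0 : 0 <= T.
Let K := b * T + L + 1.

Lemma box_ge0 : 0 <= K.
Proof. by rewrite /K !addr_ge0// ?mulr_ge0// ltW ?(de_b S) ?(de_L S). Qed.

Lemma vanish_W t : 0 <= t <= T -> [/\ vanishes K W1 t, vanishes K W2 t,
  vanishes K (partial AT W1) t & vanishes K (partial AT W2) t].
Proof.
move=> tT; have /andP[t0 _] := tT.
by split; apply: (vanishes_of_supp (de_b S) (de_L S) tT) => x y /(damped_supp S t0)[].
Qed.

Lemma vanish_primitive t : 0 <= t <= T ->
  vanishes K (primitive W1) t /\ vanishes K (primitive W2) t.
Proof.
move=> tT; have /andP[t0 _] := tT.
by split; apply: (vanishes_of_supp (de_b S) (de_L S) tT) => x y /(primitive_supp S t0)[].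
Qed.

Lemma derive_energy t : 0 < t < T ->
  'D_1 (int_box K (density a2 e u v)) t = - int_box K (weigh V (kinetic u v)) t.
Proof.
move=> /andP[t0 tT]; have tT' : 0 <= t <= T by rewrite !ltW.
have [_ _ w1 w2] := vanish_W tT'.
have [_ ->] := is_derive_energy a2 e ju jv box_ge0 w1 w2.
rewrite -mulN1r -(int_boxZ _ _ box_ge0 (cont3_weigh (cont3_kinetic ju jv))).
apply: eq_int_box => x y _ _ /=.
rewrite [X in _ * X + _](de_eq1 S x y t0) [X in _ + _ * X](de_eq2 S x y t0) /weigh /kinetic /=.
ring.
Qed.

Lemma derive_virial t : 0 < t < T ->
  'D_1 (int_box K (virial u v)) t = int_box K (kinetic u v) t - int_box K (potential a2 e u v) t
    - int_box K (weigh V (virial u v)) t.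
Proof.
move=> /andP[t0 tT]; have tT' : 0 <= t <= T by rewrite !ltW.
have [w1 w2 _ _] := vanish_W tT'.
have [_ ->] := is_derive_virial a2 e ju jv box_ge0 w1 w2.
have k1 := cont3_kinetic ju jv; have k2 := @cont3_potential _ a2 e _ _ ju jv.
have k3 := cont3_weigh cont3_virial.
have k4 : cont3 (fun t x y => kinetic u v t x y + -1 * potential a2 e u v t x y) by cont3_of.
have k5 : cont3 (fun t x y => -1 * potential a2 e u v t x y) by cont3_of.
have k6 : cont3 (fun t x y => -1 * weigh V (virial u v) t x y) by cont3_of.
rewrite -[X in _ + X + _]mulN1r -[X in _ + X]mulN1r -(int_boxZ _ _ box_ge0 k2) -(int_boxZ _ _ box_ge0 k3).
rewrite -(int_boxD _ box_ge0 k1 k5) -(int_boxD _ box_ge0 k4 k6).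
apply: eq_int_box => x y _ _ /=.
rewrite [X in _ + _ * X + _](de_eq1 S x y t0) [X in _ + _ * X](de_eq2 S x y t0) /weigh /virial /=.
ring.
Qed.

Lemma derive_mass t : 'D_1 (int_box K (mass W1 W2)) t = 2 * int_box K (virial u v) t.
Proof.
have [_ ->] := is_derive_int_box t box_ge0 is_partial_mass.
exact: (int_boxZ _ _ box_ge0 cont3_virial).
Qed.

Lemma derive_weigh_mass t :
  'D_1 (int_box K (weigh V (mass W1 W2))) t = 2 * int_box K (weigh V (virial u v)) t.
Proof.
have [_ ->] := is_derive_int_box t box_ge0 (is_partial_weigh is_partial_mass).
rewrite -(int_boxZ _ _ box_ge0 (cont3_weigh cont3_virial)).
by apply: eq_int_box => x y _ _; rewrite /weigh mulrCA.
Qed.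

(** Since the source [F] does not depend on time, its power [F . v_t] is the time derivative of
    [F . v] and can be moved inside the energy of the primitive [v]; only the dissipation is left in
    the derivative. *)
Definition work_energy (t : R) : R := int_box K (density a2 e pu pv) t
  - int_box K (work (source V W1) (source V W2) (primitive W1) (primitive W2)) t.

Lemma is_partial_work : is_partial AT
  (work (source V W1) (source V W2) (primitive W1) (primitive W2))
  (work (source V W1) (source V W2) W1 W2).
Proof.
have [s1 s2] := cont3_source S.
have q1 := is_partial_cstT s1; have q2 := is_partial_cstT s2.
have q3 := jet_t jpu; have q4 := jet_t jpv; rewrite /= in q3 q4.
have := is_partialD (is_partialM q1 q3) (is_partialM q2 q4).
move/is_partial_eq; apply => t x y; rewrite /work /source; ring.
Qed.

Lemma is_derive_work_energy (t : R) :
  is_derive t 1 work_energy ('D_1 work_energy t).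
Proof.
apply: derivableP; apply: derivableB.
- by case: (is_derive_int_box t box_ge0 (is_partial_density a2 e jpu jpv)).
- by case: (is_derive_int_box t box_ge0 is_partial_work).
Qed.

Lemma derive_work_energy t : 0 < t < T ->
  'D_1 work_energy t = - int_box K (weigh V (mass W1 W2)) t.
Proof.
move=> /andP[t0 tT]; have tT' : 0 <= t <= T by rewrite !ltW.
have [w1 w2 _ _] := vanish_W tT'.
have dD := @is_derive_energy _ a2 e _ _ jpu jpv K t box_ge0 w1 w2.
have dW := is_derive_int_box t box_ge0 is_partial_work.
have [_ ->] := is_deriveB dD dW.
have [s1 s2] := cont3_source S.
have k1 := cont3_weigh cont3_mass.
have k2 := is_partial_cont3' is_partial_work.
have k3 : cont3 (fun t x y => -1 * weigh V (mass W1 W2) t x y) by cont3_of.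
apply/eqP; rewrite subr_eq -mulN1r -(int_boxZ _ _ box_ge0 k1) -(int_boxD _ box_ge0 k3 k2).
apply/eqP; apply: eq_int_box => x y _ _ /=.
have [E1 E2] := primitive_equation S x y (ltW t0).
rewrite [X in _ * X + _]E1 [X in _ + _ * X]E2 /weigh /mass /work.
ring.
Qed.

Lemma kinetic_le_weigh t : 0 <= t <= T ->
  kappa / b * int_box K (kinetic u v) t <= (t + (1 + L) / b) * int_box K (weigh V (kinetic u v)) t.
Proof.
move=> tT; have /andP[t0 _] := tT.
have k1 := cont3_kinetic ju jv; have k2 := cont3_weigh k1.
rewrite -(int_boxZ _ _ box_ge0 k1) -(int_boxZ _ _ box_ge0 k2).
apply: le_int_box; [exact: box_ge0|by cont3_of|by cont3_of|].
move=> x y _ _; rewrite /weigh mulrA.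
have [h|h] := leP (x ^+ 2 + y ^+ 2) ((b * t + L) ^+ 2).
  by apply: ler_wpM2r; [rewrite /kinetic addr_ge0 ?sqr_ge0|exact: damped_V_lower].
have [_ _ z1 z2] := damped_supp S t0 h.
by rewrite /kinetic /= z1 z2 expr0n /= addr0 !mulr0.
Qed.

Lemma mass_le_weigh t : 0 <= t <= T ->
  kappa / b * int_box K (mass W1 W2) t <= (t + (1 + L) / b) * int_box K (weigh V (mass W1 W2)) t.
Proof.
move=> tT; have /andP[t0 _] := tT.
have k1 := cont3_mass; have k2 := cont3_weigh k1.
rewrite -(int_boxZ _ _ box_ge0 k1) -(int_boxZ _ _ box_ge0 k2).
apply: le_int_box; [exact: box_ge0|by cont3_of|by cont3_of|].
move=> x y _ _; rewrite /weigh mulrA.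
have [h|h] := leP (x ^+ 2 + y ^+ 2) ((b * t + L) ^+ 2).
  by apply: ler_wpM2r; [rewrite /mass addr_ge0 ?sqr_ge0|exact: damped_V_lower].
have [z1 z2 _ _] := damped_supp S t0 h.
by rewrite /mass z1 z2 expr0n /= addr0 !mulr0.
Qed.

(** The form is the integral of [|l u_t + u|^2]; [l] is left free for the completion of the square
    in [weighted_energy_coercive]. *)
Lemma virial_form_ge0 t l :
  0 <= l ^+ 2 * int_box K (kinetic u v) t + 2 * l * int_box K (virial u v) t
       + int_box K (mass W1 W2) t.
Proof.
have k1 := cont3_kinetic ju jv; have k2 := cont3_virial; have k3 := cont3_mass.
have k4 : cont3 (fun t x y => l ^+ 2 * kinetic u v t x y) by cont3_of.
have k5 : cont3 (fun t x y => 2 * l * virial u v t x y) by cont3_of.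
rewrite -(int_boxZ _ _ box_ge0 k1) -(int_boxZ _ _ box_ge0 k2) -(int_boxD _ box_ge0 k4 k5).
rewrite -(int_boxD _ box_ge0 (cont3D k4 k5) k3).
apply: int_box_ge0; [exact: box_ge0|by cont3_of|move=> x y _ _].
rewrite /kinetic /virial /mass /=.
rewrite [X in 0 <= X](_ : _ = (l * partial AT W1 t x y + W1 t x y) ^+ 2
  + (l * partial AT W2 t x y + W2 t x y) ^+ 2); last by ring.
by rewrite addr_ge0 ?sqr_ge0.
Qed.

Lemma densityE t : int_box K (density a2 e u v) t =
  2^-1 * (int_box K (kinetic u v) t + int_box K (potential a2 e u v) t).
Proof.
have k1 := cont3_kinetic ju jv; have k2 := @cont3_potential _ a2 e _ _ ju jv.
by rewrite -(int_boxD _ box_ge0 k1 k2) -(int_boxZ _ _ box_ge0 (cont3D k1 k2)).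
Qed.

Lemma potential_ge0 (w z : jet (R := R)) t x y : 0 <= potential a2 e w z t x y.
Proof. by have ha := ltW (de_a2 S); have he := de_e S; rewrite /potential; nonneg. Qed.

Lemma box_energy_bound k :
  1 < k -> k <= 2 -> k <= kappa / b -> k < 2 * (kappa / b - k + 1) ->
  (1 - k / (2 * (kappa / b - k + 1))) *
    ((T + (1 + L) / b) `^ k * int_box K (density a2 e u v) T) <=
  weighted_energy k ((1 + L) / b) (int_box K (density a2 e u v)) (int_box K (virial u v))
    (int_box K (weigh V (mass W1 W2))) (int_box K (mass W1 W2)) 0
  + source_cst (kappa / b) k ((1 + L) / b) * (work_energy 0 - work_energy T).
Proof.
move=> k1 k2 kb kk.
have L0 := de_L S; have b0 := de_b S.
have T00 : 0 < (1 + L) / b by rewrite divr_gt0 ?addr_gt0.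
have V0 := damped_ge0 S.
have cK := cont3_kinetic ju jv; have cP := @cont3_potential _ a2 e _ _ ju jv.
have cM := cont3_weigh cont3_mass.
have dE t := is_derive_int_boxD t box_ge0 (is_partial_density a2 e ju jv).
have dM t := is_derive_int_boxD t box_ge0 (is_partial_virial a2 e ju jv).
have dN t := is_derive_int_boxD t box_ge0 (is_partial_weigh is_partial_mass).
have dQ t := is_derive_int_boxD t box_ge0 is_partial_mass.
have S0 : forall t, 0 <= int_box K (kinetic u v) t.
  by move=> t; apply: (int_box_ge0 box_ge0 cK) => x y _ _; rewrite addr_ge0 ?sqr_ge0.
have P0 : forall t, 0 <= int_box K (potential a2 e u v) t.
  by move=> t; apply: (int_box_ge0 box_ge0 cP) => x y _ _; exact: potential_ge0.
have N0 : forall t, 0 <= int_box K (weigh V (mass W1 W2)) t.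
  move=> t; apply: (int_box_ge0 box_ge0 cM) => x y _ _.
  by rewrite mulr_ge0 ?addr_ge0 ?sqr_ge0.
exact: (weighted_energy_bound k1 k2 kb kk T00 T0 dE dM dN dQ is_derive_work_energy
  derive_energy derive_virial (fun t _ => derive_weigh_mass t) (fun t _ => derive_mass t)
  derive_work_energy densityE S0 P0 N0 kinetic_le_weigh mass_le_weigh virial_form_ge0).
Qed.

Lemma work_energy_lower : - work_energy T <= log_weight K * (8 * a2)^-1 *
  (int_box K (fun s x y => (source V W1 s x y * bracket2 s x y) ^+ 2) T
   + int_box K (fun s x y => (source V W2 s x y * bracket2 s x y) ^+ 2) T).
Proof.
have [s1 s2] := cont3_source S.
have TT : 0 <= T <= T by rewrite T0 lexx.
have [v1 v2] := vanish_primitive TT.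
have a20 := de_a2 S; have e0 := de_e S.
have c0 : 0 < a2 / 2 by rewrite divr_gt0.
have h1 := int_box_source box_ge0 c0 (jet_x jpu) (jet_y jpu) s1 v1.
have h2 := int_box_source box_ge0 c0 (jet_x jpv) (jet_y jpv) s2 v2.
rewrite (_ : 16 * (a2 / 2) = 8 * a2) in h1 h2; last by field.
rewrite mulrDr; apply: (le_trans _ (lerD h1 h2)).
have k1 := is_partial_cont3 (jet_t jpu); have k2 := is_partial_cont3 (jet_t jpv).
have k3 := is_partial_cont3 (jet_xx jpu); have k4 := is_partial_cont3 (jet_yy jpu).
have k5 := is_partial_cont3 (jet_xx jpv); have k6 := is_partial_cont3 (jet_yy jpv).
have k7 := cont3_densityp; have k8 := is_partial_cont3 is_partial_work.
have k9 : cont3 (fun t x y => -1 * density a2 e pu pv t x y) by cont3_of.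
rewrite /work_energy opprB -mulN1r -(int_boxZ _ _ box_ge0 k7) -(int_boxD _ box_ge0 k8 k9).
have cA : cont3 (fun s x y => source V W1 s x y * j_ pu s x y
    + - (a2 / 2 * (jx pu s x y ^+ 2 + jy pu s x y ^+ 2))) by cont3_of.
have cB : cont3 (fun s x y => source V W2 s x y * j_ pv s x y
    + - (a2 / 2 * (jx pv s x y ^+ 2 + jy pv s x y ^+ 2))) by cont3_of.
rewrite -(int_boxD _ box_ge0 cA cB).
apply: le_int_box; [exact: box_ge0|by cont3_of|by cont3_of|move=> x y _ _].
exact: (@work_density_le _ a2 e (primitive W1 T x y) (primitive W2 T x y)
  (jx pu T x y) (jx pv T x y) (jy pu T x y) (jy pv T x y) (W1 T x y) (W2 T x y)
  (source V W1 T x y) (source V W2 T x y) e0).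
Qed.

End box.
End decay.

(** * Growth of the logarithmic constant and decay on boxes *)

Lemma log_weight_ge1 (R : realType) (K : R) : 1 <= log_weight K.
Proof. by rewrite /log_weight lerDl ln_ge0// lerDl mulr_ge0// sqr_ge0. Qed.

(** The radius is at most [(b + L + 1) * T], so the weight is at most a constant plus [2 ln T]; for
    [T] at least [expR 1], [ln T] is at least 1 and absorbs the constant. *)
Lemma log_weight_le (R : realType) (b L T : R) : 0 < b -> 0 < L -> expR 1 <= T ->
  log_weight (b * T + L + 1) <= (3 + ln (1 + 2 * (b + L + 1) ^+ 2)) * ln T.
Proof.
move=> b0 L0 eT.
have e1 : 1 <= expR 1 :> R by rewrite -expR0 ler_expR.
have T1 : 1 <= T := le_trans e1 eT.
have T0 : 0 < T := lt_le_trans ltr01 T1.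
have lT : 1 <= ln T by rewrite -[leLHS](expRK (1 : R)) ler_ln// posrE// expR_gt0.
have B0 : 0 < b + L + 1 by lra.
have B1 : 1 <= 1 + 2 * (b + L + 1) ^+ 2 by rewrite lerDl mulr_ge0// sqr_ge0.
have lB := ln_ge0 B1.
have KT : b * T + L + 1 <= (b + L + 1) * T by rewrite !mulrDl mul1r; nra.
have K0 : 0 <= b * T + L + 1 by have := mulr_gt0 b0 T0; lra.
have T2 : 1 <= T ^+ 2 by rewrite exprn_ege1.
have hK : 1 + 2 * (b * T + L + 1) ^+ 2 <= (1 + 2 * (b + L + 1) ^+ 2) * T ^+ 2.
  have : (b * T + L + 1) ^+ 2 <= ((b + L + 1) * T) ^+ 2.
    by rewrite ler_sqr ?nnegrE// (le_trans K0).
  by rewrite exprMn; lra.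
have Kpos : 0 < 1 + 2 * (b * T + L + 1) ^+ 2 by rewrite ltr_pwDl// mulr_ge0// sqr_ge0.
have B1' := lt_le_trans ltr01 B1.
have : ln (1 + 2 * (b * T + L + 1) ^+ 2) <= ln (1 + 2 * (b + L + 1) ^+ 2) + 2 * ln T.
  rewrite (_ : 2 * ln T = ln (T ^+ 2)); last by rewrite lnXn// mulr_natl.
  rewrite -lnM ?posrE ?exprn_gt0//.
  by rewrite ler_ln// posrE ?mulr_gt0 ?exprn_gt0.
rewrite /log_weight; nra.
Qed.

Lemma le_pdivl (R : realType) (c x y : R) : 0 < c -> c * x <= y -> x <= c^-1 * y.
Proof. by move=> c0 h; rewrite ler_pdivlMl. Qed.

Lemma le_affine_log (R : realType) (WE Z Y src q l : R) : 1 <= l -> 0 <= src ->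
  - Y <= l * q -> WE + src * (Z - Y) <= (`|WE| + src * `|Z| + src * q) * l.
Proof.
move=> l1 src0 HY.
have h1 : WE <= `|WE| * l by rewrite (le_trans (ler_norm _))// ler_peMr.
have h2 : src * Z <= src * (`|Z| * l).
  by rewrite ler_wpM2l// (le_trans (ler_norm _))// ler_peMr.
have := ler_wpM2l src0 HY; lra.
Qed.

Section decay_rate.
Context {R : realType}.

(** The point is that [C] does not depend on [T] although the box does: it is built from quantities
    at time 0 and from the source, all supported in the disc of radius [L], so their integrals
    reduce to the fixed box of half-side [L + 1]. *)
Lemma damped_decay (a2 e b L kappa : R) V W1 W2 k :
  damped_elastic a2 e b L kappa V W1 W2 ->
  1 < k -> k <= 2 -> k <= kappa / b -> k < 2 * (kappa / b - k + 1) ->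
  exists C, forall T, 0 <= T ->
    (T + (1 + L) / b) `^ k
      * int_box (b * T + L + 1) (density a2 e (jet_of W1) (jet_of W2)) T
    <= C * log_weight (b * T + L + 1).
Proof.
move=> S k1 k2 kb kk.
have L0 := de_L S; have b0 := de_b S; have a20 := de_a2 S.
have [s1 s2] := cont3_source S.
have cb := is_partial_cont3 (@is_partialX_bracket2 R).
set c := 1 - k / (2 * (kappa / b - k + 1)).
have c0 : 0 < c.
  by rewrite /c subr_gt0 ltr_pdivrMr; [rewrite mul1r|lra].
set src := source_cst (kappa / b) k ((1 + L) / b).
have src0 : 0 <= src.
  rewrite /src /source_cst mulr_ge0 ?powR_ge0// mulr_ge0//.
    by rewrite divr_ge0// mulr_ge0; lra.
  by rewrite addr_ge0// divr_ge0; lra.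
set K' := L + 1.
set u := jet_of W1; set v := jet_of W2.
set WE := weighted_energy k ((1 + L) / b) (int_box K' (density a2 e u v))
  (int_box K' (virial u v)) (int_box K' (weigh V (mass W1 W2))) (int_box K' (mass W1 W2)) 0.
set Z := int_box K' (density a2 e (jet_primitive W1) (jet_primitive W2)) 0.
set I1 := int_box K' (fun s x y => (source V W1 s x y * bracket2 s x y) ^+ 2) 0.
set I2 := int_box K' (fun s x y => (source V W2 s x y * bracket2 s x y) ^+ 2) 0.
exists (c^-1 * (`|WE| + src * `|Z| + src * ((8 * a2)^-1 * (I1 + I2)))) => T T0.
have K'0 : 0 <= K' by rewrite addr_ge0 ?ltW.
have K'K : K' <= b * T + L + 1.
  by rewrite /K' lerD2r lerDr mulr_ge0// ltW.
have out x y : K' ^+ 2 <= x ^+ 2 + y ^+ 2 -> L ^+ 2 < x ^+ 2 + y ^+ 2.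
  by apply: lt_le_trans; rewrite /K' ltr_sqr ?nnegrE ?addr_ge0 ?(ltW L0)// ltrDl.
have o1 x y (h : K' ^+ 2 <= x ^+ 2 + y ^+ 2) := de_init S (out x y h).
have H := box_energy_bound S T0 k1 k2 kb kk.
have HZ := work_energy_lower S T0.
have E1 : int_box (b * T + L + 1) (density a2 e u v) 0 = int_box K' (density a2 e u v) 0.
  apply: (int_box_supp K'0 K'K (cont3_density S)) => x y /out h.
  by apply: (damped_density0 S (lexx 0)); rewrite mulr0 add0r.
have E2 : int_box (b * T + L + 1) (virial u v) 0 = int_box K' (virial u v) 0.
  apply: (int_box_supp K'0 K'K (cont3_virial S)) => x y /o1[w1 w2 _ _].
  by rewrite /virial /= w1 w2 !mul0r addr0.
have E3 : int_box (b * T + L + 1) (mass W1 W2) 0 = int_box K' (mass W1 W2) 0.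
  apply: (int_box_supp K'0 K'K (cont3_mass S)) => x y /o1[w1 w2 _ _].
  by rewrite /mass w1 w2 expr2 mulr0 addr0.
have E4 : int_box (b * T + L + 1) (weigh V (mass W1 W2)) 0 = int_box K' (weigh V (mass W1 W2)) 0.
  apply: (int_box_supp K'0 K'K (cont3_weigh S (cont3_mass S))) => x y /o1[w1 w2 _ _].
  by rewrite /weigh /mass w1 w2 expr2 mulr0 addr0 mulr0.
(* At time 0 the primitive and its space derivatives vanish: the work is 0 and the energy density is
   half of [|u_0|^2]. *)
have E5 : work_energy a2 e b L V W1 W2 T 0 = Z.
  rewrite /work_energy (@int_box_eq0 _ _ (work _ _ _ _)) ?subr0.
    apply: (int_box_supp K'0 K'K (cont3_densityp S)) => x y /o1[w1 w2 _ _].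
    rewrite /density /kinetic /potential /= w1 w2 !primitive0.
    by rewrite !expr2 !(mulr0, addr0).
  by move=> x y _ _; rewrite /work !primitive0 !mulr0 addr0.
have cS1 : cont3 (fun s x y => (source V W1 s x y * bracket2 s x y) ^+ 2) by cont3_of.
have cS2 : cont3 (fun s x y => (source V W2 s x y * bracket2 s x y) ^+ 2) by cont3_of.
(* The integrand ignores its time argument, so its integral at [T] is convertible to the one at
   0. *)
have F1 : int_box (b * T + L + 1) (fun s x y => (source V W1 s x y * bracket2 s x y) ^+ 2) T = I1.
  apply: (int_box_supp K'0 K'K cS1) => x y /o1[w1 w2 t1 t2].
  by rewrite /source w1 t1 mulr0 addr0 mul0r expr2 mulr0.
have F2 : int_box (b * T + L + 1) (fun s x y => (source V W2 s x y * bracket2 s x y) ^+ 2) T = I2.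
  apply: (int_box_supp K'0 K'K cS2) => x y /o1[w1 w2 t1 t2].
  by rewrite /source w2 t2 mulr0 addr0 mul0r expr2 mulr0.
rewrite F1 F2 -mulrA in HZ.
have HW : weighted_energy k ((1 + L) / b) (int_box (b * T + L + 1) (density a2 e u v))
  (int_box (b * T + L + 1) (virial u v)) (int_box (b * T + L + 1) (weigh V (mass W1 W2)))
  (int_box (b * T + L + 1) (mass W1 W2)) 0 = WE.
  by rewrite /WE /weighted_energy E1 E2 E3 E4.
rewrite HW E5 -/c -/src in H.
rewrite -mulrA; apply: (le_pdivl c0); apply: (le_trans H).
exact: (le_affine_log _ _ (log_weight_ge1 (b * T + L + 1)) src0 HZ).
Qed.

End decay_rate.

(** * Back to the plane *)

Section plane_integral.
Context {R : realType}.

(* The sigma-algebra is the product one: open sets of the plane belong to it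
   because they are countable unions of rational boxes. *)
Lemma open_plane_measurable (O : set (R * R)) : open O ->
  measurable (O : set (measurableTypeR R * measurableTypeR R)).
Proof.
move=> oO.
pose box (a b c d : rat) : set (R * R) :=
  `]ratr a, ratr b[%classic `*` `]ratr c, ratr d[%classic.
pose B (a b c d : rat) : set (R * R) := [set p | box a b c d `<=` O /\ box a b c d p].
have -> : O = \bigcup_a \bigcup_b \bigcup_c \bigcup_d B a b c d.
  apply/seteqP; split; last by move=> p [a _ [b _ [c _ [d _ [h]]]]]; exact: h.
  move=> [x y] Oxy.
  have := open_nbhs_nbhs (conj oO Oxy).
  move=> [[/= U1 U2] [/= [e1 /= e10 H1] [e2 /= e20 H2]] H].
  have [a] := @rat_in_itvoo R (x - e1) x ltac:(lra).
  have [b] := @rat_in_itvoo R x (x + e1) ltac:(lra).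
  have [c] := @rat_in_itvoo R (y - e2) y ltac:(lra).
  have [d] := @rat_in_itvoo R y (y + e2) ltac:(lra).
  rewrite !in_itv /= => /andP[d1 d2] /andP[c1 c2] /andP[b1 b2] /andP[a1 a2].
  exists a => //; exists b => //; exists c => //; exists d => //.
  split; last by split; rewrite /= in_itv /= ?a2 ?b1 ?c2 ?d1.
  move=> [x' y'] [/=]; rewrite !in_itv /= => /andP[x1 x2] /andP[y1 y2].
  apply: H; split => /=.
  - by apply: H1; rewrite /ball /= ltr_norml; apply/andP; split; lra.
  - by apply: H2; rewrite /ball /= ltr_norml; apply/andP; split; lra.
apply: bigcupT_measurable_rat => a; apply: bigcupT_measurable_rat => b.
apply: bigcupT_measurable_rat => c; apply: bigcupT_measurable_rat => d.
rewrite /B; have [h|h] := pselect (box a b c d `<=` O).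
  rewrite [X in measurable X](_ : _ = box a b c d).
    by apply: measurableX; exact: measurable_itv.
  by apply/seteqP; split => p //= [].
rewrite [X in measurable X](_ : _ = set0); first exact: measurable0.
by apply/seteqP; split => p //= [].
Qed.

Lemma continuous_plane_measurable (f : R * R -> R) : continuous f ->
  measurable_fun [set: measurableTypeR R * measurableTypeR R] f.
Proof.
move=> cf; apply: (measurability _ (RGenOpens.measurableE R)).
move=> _ [_ [a [b ->] <-]]; rewrite setTI; apply: open_plane_measurable.
by move/continuousP: cf; apply; exact: interval_open.
Qed.

Lemma integral_supp (K : R) (f : R -> R) : continuous f ->
  (forall x, K ^+ 2 <= x ^+ 2 -> f x = 0) -> 0 <= K ->
  (\int[@lebesgue_measure R]_x (f x)%:E = (int_cc (- K) K f)%:E)%E.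
Proof.
move=> cf f0 K0.
have <- : (\int[@lebesgue_measure R]_(x in `[(- K)%R, K]) (f x)%:E = (int_cc (- K) K f)%:E)%E.
  by rewrite /int_cc /Rintegral fineK//; apply: integrable_fin_num => //; exact: int_cc_integrable.
rewrite [RHS]integral_mkcond; apply: eq_integral => x _.
rewrite patchE; case: ifPn => //; rewrite notin_setE /= in_itv /= => /negP h.
rewrite f0// -[leRHS]real_normK ?num_real// ler_sqr ?nnegrE//.
by rewrite leNgt; apply: contra h => /ltW; rewrite ler_norml.
Qed.

(** Nonnegativity allows Tonelli's theorem, so that only measurability for the product sigma-algebra
    has to be checked. *)
Lemma integral_plane_supp (K : R) (g : R -> R -> R) : 0 <= K ->
  continuous (fun q : R * R => g q.1 q.2) -> (forall x y, 0 <= g x y) ->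
  (forall x y, K ^+ 2 <= x ^+ 2 + y ^+ 2 -> g x y = 0) ->
  (\int[@lebesgue2 R]_z (g z.1 z.2)%:E =
   (int_cc (- K) K (fun x => int_cc (- K) K (g x)))%:E)%E.
Proof.
move=> K0 cg g0 gsupp.
have mg := continuous_plane_measurable cg.
rewrite /lebesgue2 fubini_tonelli1; last 2 first.
- exact/measurable_EFinP.
- by move=> z; rewrite lee_fin.
rewrite -integral_supp//.
- apply: eq_integral => x _; rewrite /fubini_F /= (@integral_supp K (g x))//.
  + exact: continuous_section.
  + by move=> y h; apply: gsupp; apply: (le_trans h); rewrite lerDr sqr_ge0.
- by apply: (@continuous_param _ _ g) => //; lra.
- move=> x h; apply: int_cc_eq0 => y _; apply: gsupp.
  by apply: (le_trans h); rewrite lerDl sqr_ge0.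
Qed.

End plane_integral.

(** * Differential operators of the statement in curried form *)

Section curried_operators.
Context {R : realType}.
Implicit Types (f g : R -> R -> R -> R).

Lemma d1E f t : d1 (fun p : R * R => f t p.1 p.2) = fun p => partial AX f t p.1 p.2.
Proof.
apply/funext => -[x y]; rewrite /d1 /partial /derive.
apply: (congr1 (fun F : R -> R => lim (F @ 0^'))).
by apply/funext => h /=; rewrite /GRing.scale /= mulr0 add0r.
Qed.

Lemma d2E f t : d2 (fun p : R * R => f t p.1 p.2) = fun p => partial AY f t p.1 p.2.
Proof.
apply/funext => -[x y]; rewrite /d2 /partial /derive.
apply: (congr1 (fun F : R -> R => lim (F @ 0^'))).
by apply/funext => h /=; rewrite /GRing.scale /= mulr0 add0r.
Qed.

Lemma laplacianE f t x y : laplacian (fun p : R * R => f t p.1 p.2) (x, y) =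
  partial AX (partial AX f) t x y + partial AY (partial AY f) t x y.
Proof. by rewrite /laplacian d1E d2E d1E d2E. Qed.

Lemma partialD i f f' g g' t x y : is_partial i f f' -> is_partial i g g' ->
  partial i (fun t x y => f t x y + g t x y) t x y = f' t x y + g' t x y.
Proof.
by move=> pf pg; rewrite /partial; case: (is_partial_val t x y (is_partialD pf pg)).
Qed.

Lemma derive_pair (f g : R -> R) (t : R) : derivable f t 1 -> derivable g t 1 ->
  'D_1 (fun s => (f s, g s) : R * R) t = ('D_1 f t, 'D_1 g t).
Proof.
move=> df dg; have H := cvg_pair df dg.
rewrite /derive; apply: cvg_lim => //; exact: H.
Qed.

(** [u] agrees with its smooth extension only for nonnegative times, so time derivatives are
    compared through equality near a positive time; the form allows iteration on [dt u]. *)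
Lemma dt_near (u : R -> R * R -> R * R) f g (t : R) (p : R * R) :
  is_partial AT f (partial AT f) -> is_partial AT g (partial AT g) ->
  (\forall s \near t, u s p = (f s p.1 p.2, g s p.1 p.2)) ->
  dt u t p = (partial AT f t p.1 p.2, partial AT g t p.1 p.2).
Proof.
move=> pf pg E; rewrite /dt (near_eq_derive _ E) derive_pair//.
- by case: (is_partial_val t p.1 p.2 pf).
- by case: (is_partial_val t p.1 p.2 pg).
Qed.

End curried_operators.

Lemma fsupp_eq0 (T : topologicalType) (W : zmodType) (f : T -> W) (A : set T) x :
  fsupp f `<=` A -> ~ A x -> f x = 0.
Proof.
move=> fA nA; apply/eqP; apply/negPn/negP => fx; apply/nA/fA.
exact: subset_closure.
Qed.

(** Links the one-sided limit in [initial_data] with the two-sided derivative of the smooth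
    extension at time 0. *)
Lemma is_derive1_right (R : realType) (f : R -> R) (d l : R) : is_derive (0 : R) 1 f d ->
  (fun h : R => h^-1 * (f h - f 0)) @ 0^'+ --> l -> d = l.
Proof.
move=> df; apply: cvg_unique => //.
apply/cvgrPdist_le => e e0; have := (is_derive1_epsP _ _ _).1 df e e0.
rewrite /at_right /dnbhs !near_withinE; apply: filterS => h + h0.
by rewrite gt_eqF// addr0 distrC => /(_ isT).
Qed.

Lemma isolate_damping (R : realType) (A B C D : R) :
  A - B - C + D = 0 -> A - (B + C) = - D.
Proof. by move=> /eqP; rewrite addr_eq0 => /eqP <-; rewrite opprD addrA. Qed.

Section solution.
Context {R : realType}.
Variables (a b L V0 : R) (V : R * R -> R) (u0 u1 : R * R -> R * R) (u : R -> R * R -> R * R).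
Variable (w : R * (R * R) -> R * R).
Hypotheses (a0 : 0 < a) (ab : a < b) (L0 : 0 < L) (V00 : 0 < V0).
Hypothesis Vsmooth : smooth V.
Hypothesis Vlower : forall x : R * R, V0 / (1 + enorm x) <= V x.
Hypothesis supp : fsupp u0 `|` fsupp u1 `<=` [set x : R * R | enorm x <= L].
Hypotheses (wsmooth : smooth w) (uw : forall t x, 0 <= t -> u t x = w (t, x)).
Hypothesis eq : elastic_equation a b V u.
Hypothesis init : initial_data u u0 u1.

Definition curried1 (t x y : R) : R := (w (t, (x, y))).1.
Definition curried2 (t x y : R) : R := (w (t, (x, y))).2.

Lemma smooth3_curried1 n : smooth3 n curried1.
Proof.
apply: (smooth3_Ck (pi := fst) _ _ (wsmooth n)); first exact: continuous_fst.
by [].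
Qed.

Lemma smooth3_curried2 n : smooth3 n curried2.
Proof.
apply: (smooth3_Ck (pi := snd) _ _ (wsmooth n)); first exact: continuous_snd.
by [].
Qed.

Lemma uE t p : 0 <= t -> u t p = (curried1 t p.1 p.2, curried2 t p.1 p.2).
Proof. by case: p => x y t0; rewrite uw// /curried1 /curried2 -surjective_pairing. Qed.

Lemma dt_uE t p : 0 < t ->
  dt u t p = (partial AT curried1 t p.1 p.2, partial AT curried2 t p.1 p.2).
Proof.
move=> t0; apply: dt_near.
- by case: (smooth3_curried1 1 AT).
- by case: (smooth3_curried2 1 AT).
- near=> s; apply: uE; apply: ltW; near: s; exact: lt_nbhsr.
Unshelve. all: by end_near. Qed.

Lemma dtt_uE t p : 0 < t -> dt (dt u) t p =
  (partial AT (partial AT curried1) t p.1 p.2, partial AT (partial AT curried2) t p.1 p.2).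
Proof.
move=> t0; apply: dt_near.
- by case: ((smooth3_curried1 2 AT).2 AT).
- by case: ((smooth3_curried2 2 AT).2 AT).
- near=> s; apply: dt_uE; near: s; exact: lt_nbhsr.
Unshelve. all: by end_near. Qed.

Lemma comp1E t : 0 <= t -> comp1 (u t) = fun p => curried1 t p.1 p.2.
Proof. by move=> t0; apply/funext => p; rewrite /comp1 uE. Qed.

Lemma comp2E t : 0 <= t -> comp2 (u t) = fun p => curried2 t p.1 p.2.
Proof. by move=> t0; apply/funext => p; rewrite /comp2 uE. Qed.

Lemma divergenceE t : 0 <= t -> divergence (u t) =
  fun p => partial AX curried1 t p.1 p.2 + partial AY curried2 t p.1 p.2.
Proof. by move=> t0; rewrite /divergence comp1E// comp2E// d1E d2E. Qed.

Lemma grad_divergenceE t x y : 0 <= t -> grad (divergence (u t)) (x, y) =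
  (partial AX (partial AX curried1) t x y + partial AX (partial AY curried2) t x y,
   partial AY (partial AX curried1) t x y + partial AY (partial AY curried2) t x y).
Proof.
move=> t0; rewrite /grad divergenceE//.
have [_ s1] := smooth3_curried1 2 AX; have [_ s2] := smooth3_curried2 2 AY.
rewrite (d1E (fun t x y => partial AX curried1 t x y + partial AY curried2 t x y)).
rewrite (d2E (fun t x y => partial AX curried1 t x y + partial AY curried2 t x y)) /=.
by rewrite (partialD _ _ _ (s1 AX).1 (s2 AX).1) (partialD _ _ _ (s1 AY).1 (s2 AY).1).
Qed.

Lemma equation_curried t x y : 0 < t ->
  partial AT (partial AT curried1) t x y
    - elastic1 (a ^+ 2) (b ^+ 2 - a ^+ 2) (jet_of curried1) (jet_of curried2) t x y
    = - (V (x, y) * partial AT curried1 t x y) /\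
  partial AT (partial AT curried2) t x y
    - elastic2 (a ^+ 2) (b ^+ 2 - a ^+ 2) (jet_of curried1) (jet_of curried2) t x y
    = - (V (x, y) * partial AT curried2 t x y).
Proof.
move=> t0; have := eq (x, y) t0.
rewrite dtt_uE// dt_uE// grad_divergenceE ?ltW// /vlaplacian comp1E ?ltW// comp2E ?ltW//.
rewrite !laplacianE /= => -[E1 E2].
by split; [exact: (isolate_damping E1)|exact: (isolate_damping E2)].
Qed.

Lemma init_curried x y : L ^+ 2 < x ^+ 2 + y ^+ 2 ->
  [/\ curried1 0 x y = 0, curried2 0 x y = 0,
     partial AT curried1 0 x y = 0 & partial AT curried2 0 x y = 0].
Proof.
move=> xy; have nA : ~ [set x : R * R | enorm x <= L] (x, y).
  apply/negP; rewrite -ltNge /enorm /sqnorm /=.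
  by rewrite -ltr_sqr ?nnegrE ?sqrtr_ge0 ?(ltW L0)// sqr_sqrtr// addr_ge0 ?sqr_ge0.
have z0 : u0 (x, y) = 0.
  by apply: fsupp_eq0 nA; apply: subset_trans supp; exact: subsetUl.
have z1 : u1 (x, y) = 0.
  by apply: fsupp_eq0 nA; apply: subset_trans supp; exact: subsetUr.
have [i0 i1] := init (x, y); rewrite z0 in i0; rewrite z1 in i1.
have := i0; rewrite uE// => -[c1 c2].
split => //.
- have [p1 _] := smooth3_curried1 1 AT.
  apply: (is_derive1_right (is_partial_val 0 x y p1)).
  have := cvg_comp _ _ i1 (@continuous_fst R R 0); apply: cvg_trans; apply: near_eq_cvg.
  near=> h; have h0 : 0 <= h by apply: ltW; near: h; exact: nbhs_right_gt.
  by rewrite /= !uE.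
- have [p2 _] := smooth3_curried2 1 AT.
  apply: (is_derive1_right (is_partial_val 0 x y p2)).
  have := cvg_comp _ _ i1 (@continuous_snd R R 0); apply: cvg_trans; apply: near_eq_cvg.
  near=> h; have h0 : 0 <= h by apply: ltW; near: h; exact: nbhs_right_gt.
  by rewrite /= !uE.
Unshelve. all: by end_near. Qed.

Lemma damped_curried : damped_elastic (a ^+ 2) (b ^+ 2 - a ^+ 2) b L V0
  (fun x y => V (x, y)) curried1 curried2.
Proof.
have b0 : 0 < b := lt_trans a0 ab.
split => //.
- exact: smooth3_curried1.
- exact: smooth3_curried2.
- have cV : continuous V := Vsmooth 0.
  have c12 : continuous (fun p : R * R * R => p.1.2) :=
    continuous_comp2 continuous_fst continuous_snd.
  have H : continuous (fun p : R * R * R => (p.1.2, p.2)) :=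
    continuous_pair c12 continuous_snd.
  exact: (@continuous_comp2 _ _ _ _ _ H cV).
- by rewrite exprn_gt0.
- by rewrite subr_ge0 ler_sqr ?nnegrE ltW.
- by rewrite addrC subrK.
- by move=> x y; exact: (Vlower (x, y)).
- by move=> t x y /(equation_curried x y)[].
- by move=> t x y /(equation_curried x y)[].
- exact: init_curried.
Qed.

Lemma energyE t : 0 < t -> energy a b u t = (int_box (b * t + L + 1)
  (density (a ^+ 2) (b ^+ 2 - a ^+ 2) (jet_of curried1) (jet_of curried2)) t)%:E.
Proof.
move=> t0; have S := damped_curried.
have b0 : 0 < b := lt_trans a0 ab.
set J1 := jet_of curried1; set J2 := jet_of curried2.
have cd := cont3_density S.
rewrite /energy.
have E (p : R * R) : sqnorm (dt u t p) + a ^+ 2 * sqnorm_grad (u t) p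
    + (b ^+ 2 - a ^+ 2) * divergence (u t) p ^+ 2 =
    2 * density (a ^+ 2) (b ^+ 2 - a ^+ 2) J1 J2 t p.1 p.2.
  rewrite dt_uE// divergenceE ?ltW// /sqnorm_grad /grad comp1E ?ltW// comp2E ?ltW//.
  rewrite !d1E !d2E /sqnorm /density /kinetic /potential /=.
  by field.
under eq_integral do rewrite E.
have K0 : 0 <= b * t + L + 1 by rewrite !addr_ge0// ?mulr_ge0// ltW.
rewrite (integral_plane_supp (g := fun x y =>
  2 * density (a ^+ 2) (b ^+ 2 - a ^+ 2) J1 J2 t x y) K0).
- rewrite -EFinM -/(int_box _ (fun t x y => 2 * density _ _ J1 J2 t x y) t).
  by rewrite (int_boxZ _ _ K0 cd) mulKf.
- have c2 : cont3 (fun t x y => 2 * density (a ^+ 2) (b ^+ 2 - a ^+ 2) J1 J2 t x y).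
    by apply: cont3M => //; exact: cont3_cst.
  exact: (@cont3_section _ _ t c2).
- move=> x y; rewrite mulr_ge0//; apply: density_ge0; first exact: sqr_ge0.
  exact: (de_e S).
- move=> x y h; rewrite (damped_density0 S (ltW t0)) ?mulr0//.
  apply: lt_le_trans h; rewrite ltr_sqr ?nnegrE ?ltrDl//.
  by rewrite !addr_ge0// ?mulr_ge0// ltW.
Qed.

End solution.

(** * Asymptotic form of the estimates *)

Lemma ebigO_pinfty_le (R : realType) (f : R -> \bar R) (I g : R -> R) (C A : R) :
  (forall t, A <= t -> f t = (I t)%:E) -> (forall t, A <= t -> 0 <= I t <= C * g t) ->
  ebigO_pinfty f g.
Proof.
move=> fI IC; split.
  by near=> t; rewrite fI//; near: t; exact: nbhs_pinfty_ge.
(* The constant must be positive, while [C] has no prescribed sign. *)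
apply/eqO_exP; exists (`|C| + 1); first by rewrite ltr_wpDl.
have nearA := @nbhs_pinfty_ge R A (num_real A).
apply: filterS nearA => t At.
have /andP[I0 Ig] := IC t At.
rewrite fI//= ger0_norm// (le_trans Ig)// (le_trans (ler_norm _))// normrM.
by rewrite ler_wpM2r// lerDl.
Unshelve. all: by end_near. Qed.

(** Both regimes of the theorem are instances, for two choices of [k]. Starting at [expR 1] makes
    [ln t] at least 1, as [log_weight_le] requires. *)
Lemma energy_decay (R : realType) (a b L V0 : R)
    (V : R * R -> R) (u0 u1 : R * R -> R * R) (u : R -> R * R -> R * R) (k : R)
    (ha : 0 < a) (hab : a < b) (hL : 0 < L) (hV0 : 0 < V0)
    (hVsmooth : smooth V)
    (hVlower : forall x : R * R, V0 / (1 + enorm x) <= V x)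
    (hsupp : fsupp u0 `|` fsupp u1 `<=` [set x : R * R | enorm x <= L])
    (husmooth : smooth_on_halfspace u)
    (heq : elastic_equation a b V u)
    (hinit : initial_data u u0 u1) :
  1 < k -> k <= 2 -> k <= V0 / b -> k < 2 * (V0 / b - k + 1) ->
  exists (I : R -> R) (C : R), (forall t, expR 1 <= t -> energy a b u t = (I t)%:E) /\
    (forall t, expR 1 <= t -> 0 <= I t <= C * (t `^ (- k) * ln t)).
Proof.
move=> k1 k2 kb kk; have [w ws uw] := husmooth.
have S := damped_curried ha hab hL hV0 hVsmooth hVlower hsupp ws uw heq hinit.
have [C HC] := damped_decay S k1 k2 kb kk.
have b0 : 0 < b := lt_trans ha hab.
pose B : R := 3 + ln (1 + 2 * (b + L + 1) ^+ 2).
exists (fun t => int_box (b * t + L + 1)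
  (density (a ^+ 2) (b ^+ 2 - a ^+ 2) (jet_of (curried1 w)) (jet_of (curried2 w))) t), (`|C| * B).
have t_gt0 (t : R) : expR 1 <= t -> 0 < t by apply: lt_le_trans; exact: expR_gt0.
split=> t et; have t0 := t_gt0 t et.
  exact: (energyE ha hab hL hV0 hVsmooth hVlower hsupp ws uw heq hinit t0).
have K0 : 0 <= b * t + L + 1 by rewrite !addr_ge0// ?mulr_ge0// ltW.
have I0 : 0 <= int_box (b * t + L + 1)
    (density (a ^+ 2) (b ^+ 2 - a ^+ 2) (jet_of (curried1 w)) (jet_of (curried2 w))) t.
  apply: (int_box_ge0 K0 (cont3_density S)) => x y _ _.
  by apply: density_ge0; [exact: sqr_ge0|exact: (de_e S)].
apply/andP; split=> //; have := HC t (ltW t0); move: (int_box _ _ _) I0 => I I0 HI.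
have lw := log_weight_le b0 hL et; have lw1 := log_weight_ge1 (b * t + L + 1).
move: (log_weight _) lw lw1 HI => l lw lw1 HI.
have T0 : 0 <= (1 + L) / b by rewrite divr_ge0 ?addr_ge0// ltW.
have tk : 0 < t `^ k by exact: powR_gt0.
(* The time shift is dropped from the weight, which is legitimate because the energy [I] is
   nonnegative. *)
have tT : t `^ k * I <= (t + (1 + L) / b) `^ k * I.
  apply: ler_wpM2r => //; apply: ge0_ler_powR; rewrite ?nnegrE ?lerDl//.
  - exact: ltW (lt_trans ltr01 k1).
  - exact: ltW.
  - exact: addr_ge0 (ltW t0) T0.
have HB : C * l <= `|C| * (B * ln t).
  apply: (le_trans (ler_norm _)); rewrite normrM ler_wpM2l// ger0_norm//.
  by rewrite (le_trans _ lw1).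
rewrite powRN mulrCA ler_pdivlMl//.
by rewrite (le_trans tT)// (le_trans HI)// (le_trans HB)// mulrA.
Qed.

Theorem theorem1p1 (R : realType) (a b L V0 : R)
    (V : R * R -> R) (u0 u1 : R * R -> R * R) (u : R -> R * R -> R * R)
    (ha : 0 < a) (hab : a < b) (hL : 0 < L) (hV0 : 0 < V0)
    (hVsmooth : smooth V)
    (hVbounded : bounded_fun V)
    (hVlower : forall x : R * R, V0 / (1 + enorm x) <= V x)
    (hVupper : forall x : R * R,
       ((V x)%:E <= 'N[@lebesgue2 R]_(+oo) [EFin \o V])%E)
    (hVfinite : ('N[@lebesgue2 R]_(+oo) [EFin \o V] < +oo)%E)
    (hu0 : test_function u0) (hu1 : test_function u1)
    (hsupp : fsupp u0 `|` fsupp u1 `<=` [set x : R * R | enorm x <= L])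
    (husmooth : smooth_on_halfspace u)
    (heq : elastic_equation a b V u)
    (hinit : initial_data u u0 u1) :
  (2 * b < V0 ->
     ebigO_pinfty (energy a b u) (fun t : R => t ^- 2 * ln t)) /\
  (b < V0 -> V0 <= 2 * b ->
     forall delta : R, 0 < delta ->
       ebigO_pinfty (energy a b u)
         (fun t : R => t `^ (- (V0 / b) + delta) * ln t)).
Proof.
have b0 : 0 < b := lt_trans ha hab.
have e1 : 1 <= expR 1 :> R by rewrite -expR0 ler_expR.
split=> [V2|V1 V2 delta d0].
  have Vb : 2 < V0 / b by rewrite ltr_pdivlMr.
  (* With [k = 2] the coercivity condition reads [2 < 2 * (V0 / b - 1)], that is [V0 > 2 b]. *)
  have [//||||I [C [EI IC]]] := @energy_decay R a b L V0 V u0 u1 u 2 ha hab hL hV0 hVsmooth hVlower hsupp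
    husmooth heq hinit; [lra|lra|lra|lra|].
  apply: (ebigO_pinfty_le (C := C) EI) => t et; have := IC t et.
  have t0 : 0 <= t := le_trans (expR_ge0 1) et.
  by rewrite powR_invn.
have Vb1 : 1 < V0 / b by rewrite ltr_pdivlMr ?mul1r.
have Vb2 : V0 / b <= 2 by rewrite ler_pdivrMr.
(* The minimum with half of [V0 / b - 1] keeps [k = V0 / b - d] above 1 even when [delta] is large.
   Coercivity reads [V0 / b - d < 2 * (1 + d)], which follows from [V0 / b <= 2]. *)
pose d := Num.min delta ((V0 / b - 1) / 2).
have d1 : d <= delta by rewrite ge_min lexx.
have d2 : d <= (V0 / b - 1) / 2 by rewrite ge_min lexx orbT.
have dpos : 0 < d by rewrite lt_min d0 divr_gt0// subr_gt0.
have [||||I [C [EI IC]]] := @energy_decay R a b L V0 V u0 u1 u (V0 / b - d) ha hab hL hV0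
  hVsmooth hVlower hsupp husmooth heq hinit; [lra|lra|lra|lra|].
apply: (ebigO_pinfty_le (C := `|C|) EI) => t et; have /andP[-> h] := IC t et.
have t1 : 1 <= t := le_trans e1 et.
apply: (le_trans h); apply: (le_trans (ler_norm _)); rewrite normrM ler_wpM2l//.
rewrite ger0_norm ?mulr_ge0 ?powR_ge0 ?ln_ge0// ler_wpM2r ?ln_ge0//.
by rewrite opprB addrC ler_powR// lerD2l.
Qed.
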